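(* Let $\lambda\ge 0$, let $\varphi(z)=1+B_1z+B_2z^2+B_3z^3+\cdots$ ($B_1>0$) be an analytic univalent function with positive real part in the open unit disk $\mathbb{D}$, and let $f(z)=z+\sum_{n=2}^\infty a_nz^n$ belong to the class $ST_\sigma^\lambda(\varphi)$. Put $$D=(1+4\lambda)B_1^2+(B_1-B_2)(1+2\lambda)^2,\qquad E=(9+44\lambda)B_1^2-8(1+2\lambda)(1+3\lambda)(B_2-B_1),$$ $$A=(B_2-B_1)+\frac{(3+8\lambda)B_1^2}{8(1+2\lambda)(1+3\lambda)}+\frac{B_1(1+2\lambda)^2}{4D}\left(\frac{2(1+3\lambda)B_1^3}{(1+2\lambda)^3}+(B_1+B_3-2B_2)\right),$$ $$C=-\frac{(3+8\lambda)B_1^2}{8(1+2\lambda)(1+3\lambda)}+\frac{B_1(1+2\lambda)^2}{4D}\left(\frac{2(1+3\lambda)B_1^3}{(1+2\lambda)^3}+(B_1+B_3-2B_2)\right).$$ (a) If $(1+2\lambda)^2B_1\le |D|$, then $$|a_2|\le \frac{B_1\sqrt{B_1}}{\sqrt{|D|}},$$ $$|a_3|\le\min\Bigg\{\frac{B_1}{4(1+3\lambda)|D|}\Big(\big|(3+10\lambda)B_1^2+(B_1-B_2)(1+2\lambda)^2\big|+\big|(1+2\lambda)B_1^2-(1+2\lambda)^2(B_1-B_2)\big|\Big),$$ $$\qquad\frac{B_1}{2(1+3\lambda)|D|}\Big(\big|(1+2\lambda)B_1^2-(1+2\lambda)^2(B_1-B_2)\big|+|D|\Big)\Bigg\},$$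 $$|a_4|\le\min\Bigg\{\frac{B_1}{3(1+4\lambda)}+\frac{2\sqrt{B_1}(1+2\lambda)}{3(1+4\lambda)\sqrt{|D|}}\big(|A|+|C|\big),$$ $$\qquad\frac{2B_1}{6(1+4\lambda)|E|}\Big(\big|(12+52\lambda)B_1^2-4(1+2\lambda)(1+3\lambda)(B_2-B_1)\big|+\big|(3+8\lambda)B_1^2+4(1+2\lambda)(1+3\lambda)(B_2-B_1)\big|\Big)$$ $$\qquad+\frac{2(1+2\lambda)\sqrt{B_1}}{3(1+4\lambda)\sqrt{|D|}}\left|(B_2-B_1)+\frac{B_1\big(2(1+3\lambda)B_1^3+(1+2\lambda)^3(B_1+B_3-2B_2)\big)}{2(1+2\lambda)D}\right|\Bigg\}.$$ (b) If $(1+2\lambda)^2B_1\ge |D|$, then $$|a_2|\le\frac{B_1}{1+2\lambda},$$ $$|a_3|\le\min\Bigg\{\frac{B_1}{4(1+3\lambda)|D|}\Big(\big|(3+10\lambda)B_1^2+(B_1-B_2)(1+2\lambda)^2\big|+\big|(1+2\lambda)B_1^2-(1+2\lambda)^2(B_1-B_2)\big|\Big),$$ $$\qquad\frac{1}{2(1+3\lambda)(1+2\lambda)}\Big(\big|B_1^2-(1+2\lambda)(B_1-B_2)\big|+(1+2\lambda)B_1\Big)\Bigg\},$$ $$|a_4|\le\min\Bigg\{\frac{B_1}{3(1+4\lambda)}+\frac{2}{3(1+4\lambda)}\big(|A|+|C|\big),$$ $$\qquad\frac{2B_1}{6(1+4\lambda)|E|}\Big(\big|(12+52\lambda)B_1^2-4(1+2\lambda)(1+3\lambda)(B_2-B_1)\big|+\big|(3+8\lambda)B_1^2+4(1+2\lambda)(1+3\lambda)(B_2-B_1)\big|\Big)$$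 $$\qquad+\frac{2}{3(1+4\lambda)}\left|(B_2-B_1)+\frac{B_1\big(2(1+3\lambda)B_1^3+(1+2\lambda)^3(B_1+B_3-2B_2)\big)}{2(1+2\lambda)D}\right|\Bigg\}.$$
   Context: $\mathbb{D}=\{z\in\mathbb{C}:|z|<1\}$. $\mathcal{A}$ is the class of analytic functions $f$ on $\mathbb{D}$ with $f(0)=0$, $f'(0)=1$. A function $f\in\mathcal{A}$ is bi-univalent if $f$ is univalent (injective) in $\mathbb{D}$ and its inverse $f^{-1}$ (defined near $0$) has a univalent analytic continuation $g$ to $\mathbb{D}$; $\sigma$ denotes the class of bi-univalent functions. For analytic functions $F,G$ on $\mathbb{D}$, $F\prec G$ ($F$ is subordinate to $G$) means there is an analytic $w$ on $\mathbb{D}$ with $w(0)=0$, $|w(z)|<1$ and $F(z)=G(w(z))$. The function $\varphi$ is analytic and univalent in $\mathbb{D}$ with positive real part, $\varphi(0)=1$, $\varphi'(0)=B_1>0$. For $\lambda\ge0$, $ST^\lambda(\varphi)$ is the class of $f\in\mathcal{A}$ with $$\frac{zf'(z)}{f(z)}+\lambda\frac{z^2f''(z)}{f(z)}\prec\varphi(z)\quad(z\in\mathbb{D}).$$ $ST_\sigma^\lambda(\varphi)$ is the class of $f\in\sigma$ such that both $f$ and $g$ belong to $ST^\lambda(\varphi)$, where $g$ is the analytic continuation of $f^{-1}$ to $\mathbb{D}$. Convention: a displayed bound is asserted only when its denominators are nonzero; inside a minimum, an entry having a vanishing denominator is disregarded. *)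

(* Defs.v *)
From Stdlib Require Import Reals List.
From Coquelicot Require Import Coquelicot.
Open Scope R_scope.

Definition in_disk (z : C) : Prop := Cmod z < 1.

(** Functions on the disk are total functions [C -> C] of which only the values
    on the disk matter. *)
Definition analytic (f : C -> C) : Prop :=
  forall z : C, in_disk z -> ex_derive f z.

Definition univalent (f : C -> C) : Prop :=
  analytic f /\
  forall z1 z2 : C, in_disk z1 -> in_disk z2 -> f z1 = f z2 -> z1 = z2.

Definition taylor (a : nat -> C) (f : C -> C) : Prop :=
  forall z : C, in_disk z -> is_pseries a z (f z).

Definition normalized (f : C -> C) : Prop :=
  analytic f /\ f (RtoC 0) = RtoC 0 /\ is_derive f (RtoC 0) (RtoC 1).

(** [g] is an analytic univalent function on the disk that coincides near 0 with
    the inverse of [f : disk -> f(disk)]. *)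
Definition inverse_continuation (f g : C -> C) : Prop :=
  univalent g /\
  exists r : R, 0 < r /\
    forall w : C, Cmod w < r -> in_disk w /\ in_disk (g w) /\ f (g w) = w.

Definition bi_univalent (f : C -> C) : Prop :=
  normalized f /\ univalent f /\ exists g : C -> C, inverse_continuation f g.

Definition subordinate (F G : C -> C) : Prop :=
  analytic F /\ analytic G /\
  exists w : C -> C,
    analytic w /\ w (RtoC 0) = RtoC 0 /\
    (forall z : C, in_disk z -> Cmod (w z) < 1) /\
    (forall z : C, in_disk z -> F z = G (w z)).

(** The quotient is [0 / 0] at the origin, where the singularity is removable:
    [F] is its analytic extension to the whole disk. *)
Definition ST (lam : R) (phi f : C -> C) : Prop :=
  normalized f /\
  exists F : C -> C,
    (forall z : C, in_disk z -> z <> RtoC 0 ->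
       f z <> RtoC 0 /\
       F z = (z * C_derive f z / f z
              + lam * (z ^ 2 * C_derive (C_derive f) z / f z))%C) /\
    subordinate F phi.

(** The continuation [g] is unique on the disk by the identity theorem. *)
Definition ST_sigma (lam : R) (phi f : C -> C) : Prop :=
  bi_univalent f /\ ST lam phi f /\
  exists g : C -> C, inverse_continuation f g /\ ST lam phi g.

(** The coefficients [B2] and [B3] are complex, since [phi] is not assumed
    symmetric with respect to the real axis. *)
Definition coefD (lam B1 : R) (B2 : C) : C :=
  ((1 + 4 * lam) * B1 ^ 2 + (B1 - B2) * (1 + 2 * lam) ^ 2)%C.

Definition coefE (lam B1 : R) (B2 : C) : C :=
  ((9 + 44 * lam) * B1 ^ 2
   - 8 * (1 + 2 * lam) * (1 + 3 * lam) * (B2 - B1))%C.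

Definition coefA (lam B1 : R) (B2 B3 : C) : C :=
  ((B2 - B1)
   + (3 + 8 * lam) * B1 ^ 2 / (8 * (1 + 2 * lam) * (1 + 3 * lam))
   + B1 * (1 + 2 * lam) ^ 2 / (4 * coefD lam B1 B2)
     * (2 * (1 + 3 * lam) * B1 ^ 3 / (1 + 2 * lam) ^ 3
        + (B1 + B3 - 2 * B2)))%C.

Definition coefC (lam B1 : R) (B2 B3 : C) : C :=
  (- ((3 + 8 * lam) * B1 ^ 2 / (8 * (1 + 2 * lam) * (1 + 3 * lam)))
   + B1 * (1 + 2 * lam) ^ 2 / (4 * coefD lam B1 B2)
     * (2 * (1 + 3 * lam) * B1 ^ 3 / (1 + 2 * lam) ^ 3
        + (B1 + B3 - 2 * B2)))%C.

(** [le_min x es] is [x <= min es], where each entry is paired with (the product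
    of) those of its denominators that may vanish; an entry with a vanishing
    denominator is disregarded, and nothing is asserted if no entry remains. *)
Definition le_min (x : R) (es : list (C * R)) : Prop :=
  forall (d : C) (e : R), In (d, e) es -> d <> RtoC 0 -> x <= e.

(* Main.v *)
Require Import Defs.
From Stdlib Require Import Reals List Lra Lia Classical ClassicalEpsilon.
From Coquelicot Require Import Coquelicot.
Import ListNotations.
Open Scope R_scope.

(** Let [F] be the starlikeness quotient of [f], and [G] that of the inverse [g].
    Subordination gives Schwarz functions [w], [v] with [F = phi o w] and
    [G = phi o v].  Passing to [(1 + w) / (1 - w) = 1 + c1 z + c2 z^2 + c3 z^3 + ...]
    and likewise to [b1, b2, b3] for [v], which both have positive real part,
    Caratheodory's inequality bounds every [c_i] and [b_i] by 2.  Comparing the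
    first three Taylor coefficients of [F] and [G] gives six equations between
    [a2, a3, a4] and the [c_i], [b_i] ([coefficient_relations]).  They force
    [b1 = - c1] and
    [D * c1^2 = (1 + 2 lam)^2 * B1 * (c2 + b2)],
    [a3 - a2^2 = B1 * (c2 - b2) / (8 (1 + 3 lam))],
    [E * c1 * (c2 - b2) = 8 (1 + 2 lam) (1 + 3 lam) * B1 * (c3 + b3)].
    Each entry of each minimum is the triangle inequality applied to one way of
    writing [a2], [a3] or [a4] through these quantities; the two cases of the
    theorem correspond to the two bounds on [c1], namely 2 and
    [2 (1 + 2 lam) sqrt B1 / sqrt |D|], of which the smaller one is used.

    Analytic functions are only assumed complex differentiable, so Caratheodory's
    inequality rests on Goursat's theorem.  In the coordinates
    [z = exp (s + i t)] an annulus becomes a rectangle whose horizontal sides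
    carry the same values, so that Goursat's theorem ([goursat], by bisection)
    says that the mean of a function over circles does not depend on the radius.
    Hence a function continuous at 0, differentiable around it and of nonnegative
    real part on a circle has nonnegative real part at 0 ([Re_nonneg_at_centre]).
    Applied to a suitable combination of [p], powers of [z] and the remainder of
    the Taylor expansion of [p], this is [caratheodory_coefficient].

    Taylor coefficients of [w], [v], [F], [G] and [g] are never obtained from
    Cauchy's formula.  An expansion to order three at 0 with a bounded remainder
    ([jet]) suffices, and such expansions are stable under sums, products,
    inverses, composition and, by [jet_root], under taking compositional roots.
    Only [f] and [phi] are given by power series, and termwise differentiation of
    that of [f] provides the two derivatives that occur in [F] and, through
    [f (g x) = x], in [G]. *)

(** * Complex derivatives with explicit moduli *)

(** [is_derive] as an inequality between moduli, the form in which all estimates below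
    use it. *)
Definition has_cderiv (f : C -> C) (z l : C) : Prop :=
  forall eps : R, 0 < eps -> exists delta : R, 0 < delta /\
    forall y : C, Cmod (y - z) < delta ->
      Cmod (f y - f z - l * (y - z)) <= eps * Cmod (y - z).

Lemma has_cderiv_is_derive f z l : has_cderiv f z l <-> is_derive f z l.
Proof.
split.
- intros H; split.
  + apply is_linear_scal_l.
  + intros x Hx.
    assert (Hxz : x = z).
    { symmetry. apply (is_filter_lim_locally_unique (V := AbsRing_NormedModule C_AbsRing)).
      exact Hx. }
    subst x. intros eps.
    destruct (H eps (cond_pos eps)) as [d [Hd H1]].
    exists (mkposreal d Hd). intros y Hy.
    specialize (H1 y Hy).
    replace (norm _) with (Cmod (f y - f z - l * (y - z))).
    * exact H1.
    * change (Cmod (f y - f z - l * (y - z)) = Cmod (f y - f z - (y - z) * l)).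
      f_equal; ring.
- intros [_ H] eps He.
  destruct (H z (fun P H => H) (mkposreal eps He)) as [d Hd].
  exists d; split; [apply cond_pos|]. intros y Hy.
  specialize (Hd y Hy).
  change (Cmod (f y - f z - (y - z) * l) <= eps * Cmod (y - z)) in Hd.
  rewrite (Cmult_comm l). exact Hd.
Qed.

Lemma has_cderiv_continuous f z l : has_cderiv f z l ->
  forall eps, 0 < eps -> exists delta, 0 < delta /\
    forall y, Cmod (y - z) < delta -> Cmod (f y - f z) < eps.
Proof.
intros H eps He.
destruct (H 1 Rlt_0_1) as [d [Hd H1]].
pose proof (Cmod_ge_0 l) as Hl.
assert (Hq : 0 < eps / (Cmod l + 2)) by (apply Rdiv_lt_0_compat; lra).
exists (Rmin d (eps / (Cmod l + 2))); split; [now apply Rmin_pos|].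
intros y Hy.
assert (Hy1 := Rlt_le_trans _ _ _ Hy (Rmin_l _ _)).
assert (Hy2 := Rlt_le_trans _ _ _ Hy (Rmin_r _ _)).
specialize (H1 y Hy1).
replace (f y - f z)%C with ((f y - f z - l * (y - z)) + l * (y - z))%C by ring.
eapply Rle_lt_trans; [apply Cmod_triangle|]. rewrite Cmod_mult.
apply (Rmult_lt_compat_r (Cmod l + 2)) in Hy2; [|lra].
replace (eps / (Cmod l + 2) * (Cmod l + 2)) with eps in Hy2 by (field; lra).
pose proof (Cmod_ge_0 (y - z)). nra.
Qed.

Lemma has_cderiv_ext_loc f g z l r : 0 < r ->
  (forall y, Cmod (y - z) < r -> f y = g y) ->
  has_cderiv f z l -> has_cderiv g z l.
Proof.
intros Hr He H eps Heps.
destruct (H eps Heps) as [d [Hd H1]].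
exists (Rmin d r); split; [now apply Rmin_pos|]. intros y Hy.
assert (Hy1 := Rlt_le_trans _ _ _ Hy (Rmin_l _ _)).
assert (Hy2 := Rlt_le_trans _ _ _ Hy (Rmin_r _ _)).
rewrite <- (He y Hy2), <- (He z).
- now apply H1.
- replace (z - z)%C with (RtoC 0) by ring. now rewrite Cmod_0.
Qed.

Lemma has_cderiv_eq f z l l' : l = l' -> has_cderiv f z l -> has_cderiv f z l'.
Proof. now intros ->. Qed.

Lemma has_cderiv_const c z : has_cderiv (fun _ => c) z 0.
Proof. apply has_cderiv_is_derive. apply (is_derive_const (V := C_NormedModule)). Qed.

Lemma has_cderiv_id z : has_cderiv (fun x => x) z 1.
Proof.
intros eps He. exists 1. split; [lra|]. intros y _.
replace (y - z - 1 * (y - z))%C with (RtoC 0) by ring. rewrite Cmod_0.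
pose proof (Cmod_ge_0 (y - z)). nra.
Qed.

Lemma has_cderiv_plus f g z l m : has_cderiv f z l -> has_cderiv g z m ->
  has_cderiv (fun x => f x + g x)%C z (l + m).
Proof.
rewrite !has_cderiv_is_derive. intros H1 H2.
exact (is_derive_plus (V := C_NormedModule) f g z l m H1 H2).
Qed.

Lemma has_cderiv_mult f g z l m : has_cderiv f z l -> has_cderiv g z m ->
  has_cderiv (fun x => f x * g x)%C z (l * g z + f z * m).
Proof.
intros Hf Hg eps He.
pose proof (Cmod_ge_0 l) as Hl. pose proof (Cmod_ge_0 (f z)) as Hfz.
pose proof (Cmod_ge_0 (g z)) as Hgz.
set (K := Cmod l + Cmod (f z) + Cmod (g z) + 1).
assert (HK : 0 < K) by (unfold K; lra).
assert (Hk : 0 < eps / (2 * K)) by (apply Rdiv_lt_0_compat; lra).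
destruct (Hf _ Hk) as [d1 [Hd1 H1]].
destruct (Hg _ Hk) as [d2 [Hd2 H2]].
destruct (has_cderiv_continuous g z m Hg (Rmin 1 (eps / (2 * K)))) as [d3 [Hd3 H3]].
{ apply Rmin_pos; lra. }
exists (Rmin d1 (Rmin d2 d3)); split; [repeat apply Rmin_pos; lra|].
intros y Hy.
assert (Hy1 := Rlt_le_trans _ _ _ Hy (Rmin_l _ _)).
assert (Hy2 := Rlt_le_trans _ _ _ Hy (Rmin_r _ _)).
assert (Hy3 := Rlt_le_trans _ _ _ Hy2 (Rmin_r _ _)).
apply (fun h => Rlt_le_trans _ _ _ h (Rmin_l _ _)) in Hy2.
specialize (H1 y Hy1). specialize (H2 y Hy2). specialize (H3 y Hy3).
assert (H3' := Rlt_le_trans _ _ _ H3 (Rmin_l _ _)).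
apply (fun h => Rlt_le_trans _ _ _ h (Rmin_r _ _)) in H3.
replace (f y * g y - f z * g z - (l * g z + f z * m) * (y - z))%C
  with ((f y - f z - l * (y - z)) * (g z + (g y - g z))
        + l * (y - z) * (g y - g z) + f z * (g y - g z - m * (y - z)))%C by ring.
pose proof (Cmod_triangle ((f y - f z - l * (y - z)) * (g z + (g y - g z))
        + l * (y - z) * (g y - g z)) (f z * (g y - g z - m * (y - z)))) as T1.
pose proof (Cmod_triangle ((f y - f z - l * (y - z)) * (g z + (g y - g z)))
        (l * (y - z) * (g y - g z))) as T2.
pose proof (Cmod_triangle (g z) (g y - g z)) as T3.
rewrite Cmod_mult in T1. rewrite Cmod_mult, (Cmod_mult (l * _)), (Cmod_mult l) in T2.
set (x := Cmod (y - z)) in *.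
assert (Hx : 0 <= x) by apply Cmod_ge_0.
set (e := eps / (2 * K)) in *.
assert (Hee : eps = 2 * K * e) by (unfold e; field; lra).
assert (Hex : 0 <= e * x) by (apply Rmult_le_pos; lra).
assert (A1 : Cmod (f y - f z - l * (y - z)) * Cmod (g z + (g y - g z))
             <= (e * x) * (Cmod (g z) + 1)).
{ apply Rmult_le_compat; try apply Cmod_ge_0; lra. }
assert (A2 : Cmod l * x * Cmod (g y - g z) <= Cmod l * x * e).
{ apply Rmult_le_compat_l; [apply Rmult_le_pos; lra|lra]. }
assert (A3 : Cmod (f z) * Cmod (g y - g z - m * (y - z)) <= Cmod (f z) * (e * x)).
{ apply Rmult_le_compat_l; lra. }
rewrite Hee. clear He Hk Hee.
assert (2 * K * e * x = 2 * K * (e * x)) by ring.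
assert (Cmod l * x * e = Cmod l * (e * x)) by ring.
assert (e * x * (Cmod (g z) + 1) = (Cmod (g z) + 1) * (e * x)) by ring.
assert ((Cmod l + Cmod (f z) + Cmod (g z) + 1) * (e * x) <= 2 * K * (e * x)).
{ apply Rmult_le_compat_r; unfold K; lra. }
lra.
Qed.

Lemma has_cderiv_comp f g z l m : has_cderiv f (g z) l -> has_cderiv g z m ->
  has_cderiv (fun x => f (g x)) z (l * m).
Proof.
intros Hf Hg eps He.
pose proof (Cmod_ge_0 l) as Hl. pose proof (Cmod_ge_0 m) as Hm.
assert (Ha : 0 < eps / (2 * (Cmod m + 1))) by (apply Rdiv_lt_0_compat; lra).
assert (Hb : 0 < Rmin 1 (eps / (2 * (Cmod l + 1)))).
{ apply Rmin_pos; [lra|]. apply Rdiv_lt_0_compat; lra. }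
destruct (Hf _ Ha) as [d1 [Hd1 H1]].
destruct (Hg _ Hb) as [d2 [Hd2 H2]].
destruct (has_cderiv_continuous g z m Hg d1 Hd1) as [d3 [Hd3 H3]].
exists (Rmin d2 d3); split; [now apply Rmin_pos|]. intros y Hy.
assert (Hy1 := Rlt_le_trans _ _ _ Hy (Rmin_l _ _)).
assert (Hy2 := Rlt_le_trans _ _ _ Hy (Rmin_r _ _)).
specialize (H1 _ (H3 y Hy2)). specialize (H2 y Hy1).
set (x := Cmod (y - z)) in *.
assert (Hx : 0 <= x) by apply Cmod_ge_0.
replace (f (g y) - f (g z) - l * m * (y - z))%C
  with ((f (g y) - f (g z) - l * (g y - g z)) + l * (g y - g z - m * (y - z)))%C by ring.
eapply Rle_trans; [apply Cmod_triangle|]. rewrite Cmod_mult.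
assert (B1 : Cmod (g y - g z) <= (Cmod m + 1) * x).
{ replace (g y - g z)%C with ((g y - g z - m * (y - z)) + m * (y - z))%C by ring.
  eapply Rle_trans; [apply Cmod_triangle|]. rewrite Cmod_mult. fold x.
  assert (Rmin 1 (eps / (2 * (Cmod l + 1))) * x <= 1 * x)
    by (apply Rmult_le_compat_r; [lra|apply Rmin_l]). lra. }
assert (B2 : eps / (2 * (Cmod m + 1)) * Cmod (g y - g z) <= eps / 2 * x).
{ eapply Rle_trans; [apply Rmult_le_compat_l; [lra|exact B1]|].
  right; field; lra. }
assert (B3 : Cmod (g y - g z - m * (y - z)) <= eps / (2 * (Cmod l + 1)) * x).
{ eapply Rle_trans; [exact H2|]. apply Rmult_le_compat_r; [lra|apply Rmin_r]. }
assert (B4 : Cmod l * Cmod (g y - g z - m * (y - z)) <= eps / 2 * x).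
{ apply Rle_trans with ((Cmod l + 1) * (eps / (2 * (Cmod l + 1)) * x)).
  - apply Rmult_le_compat; try apply Cmod_ge_0; lra.
  - right; field; lra. }
lra.
Qed.

Lemma Cminus_lower z y : z <> RtoC 0 -> Cmod (y - z) < Cmod z / 2 -> Cmod z / 2 < Cmod y.
Proof.
intros Hz Hy.
pose proof (Cmod_triangle y (z - y)) as T.
replace (y + (z - y))%C with z in T by ring.
replace (z - y)%C with (- (y - z))%C in T by ring. rewrite Cmod_opp in T. lra.
Qed.

Lemma has_cderiv_Cinv z : z <> RtoC 0 -> has_cderiv (fun x => / x)%C z (- / (z * z)).
Proof.
intros Hz eps He.
assert (Hm : 0 < Cmod z) by now apply Cmod_gt_0.
set (m := Cmod z) in *.
assert (Hq : 0 < eps * (m * m * m) / 2).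
{ apply Rdiv_lt_0_compat; [|lra]. repeat apply Rmult_lt_0_compat; lra. }
exists (Rmin (m / 2) (eps * (m * m * m) / 2)); split; [apply Rmin_pos; lra|].
intros y Hy.
assert (Hy1 := Rlt_le_trans _ _ _ Hy (Rmin_l _ _)).
assert (Hy2 := Rlt_le_trans _ _ _ Hy (Rmin_r _ _)).
assert (Hyl := Cminus_lower z y Hz Hy1). fold m in Hyl.
assert (Hy0 : y <> RtoC 0). { apply Cmod_gt_0. lra. }
replace (/ y - / z - - / (z * z) * (y - z))%C
  with ((y - z) * (y - z) / (y * (z * z)))%C by (field; auto).
rewrite Cmod_div by (repeat apply Cmult_neq_0; auto).
rewrite !Cmod_mult. fold m. set (x := Cmod (y - z)) in *.
assert (Hx : 0 <= x) by apply Cmod_ge_0.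
apply Rle_trans with (x * x / (m / 2 * (m * m))).
- apply Rmult_le_compat_l; [nra|]. apply Rinv_le_contravar.
  + repeat apply Rmult_lt_0_compat; lra.
  + apply Rmult_le_compat_r; [nra|lra].
- replace (x * x / (m / 2 * (m * m))) with (x / (m * m * m / 2) * x) by (field; lra).
  apply Rmult_le_compat_r; [lra|].
  apply Rmult_le_reg_r with (m * m * m / 2).
  + apply Rdiv_lt_0_compat; [|lra]. repeat apply Rmult_lt_0_compat; lra.
  + replace (x / (m * m * m / 2) * (m * m * m / 2)) with x by (field; lra). lra.
Qed.

Lemma has_cderiv_inv f z l : f z <> RtoC 0 -> has_cderiv f z l ->
  has_cderiv (fun x => / f x)%C z (- / (f z * f z) * l).
Proof.
intros Hz H. apply (has_cderiv_comp (fun x => / x)%C f); [|exact H].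
now apply has_cderiv_Cinv.
Qed.

Lemma has_cderiv_scal c f z l : has_cderiv f z l ->
  has_cderiv (fun x => c * f x)%C z (c * l).
Proof.
intros H. apply (has_cderiv_eq _ _ (0 * f z + c * l)%C); [ring|].
apply (has_cderiv_mult (fun _ => c) f); [apply has_cderiv_const|exact H].
Qed.

Lemma has_cderiv_pow n z : exists l, has_cderiv (fun x => x ^ n)%C z l.
Proof.
induction n as [|n [l IH]].
- exists (RtoC 0). exact (has_cderiv_const (RtoC 1) z).
- eexists. apply (has_cderiv_mult (fun x => x) (fun x => x ^ n)%C).
  + apply has_cderiv_id.
  + exact IH.
Qed.

(** * Goursat's theorem on rectangles *)

Definition half_of (a b a' b' : R) : Prop :=
  (a' = a /\ b' = (a + b) / 2) \/ (a' = (a + b) / 2 /\ b' = b).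

(** Both sequences of end points are monotone and their distance tends to 0, so they
    have a common limit. *)
Lemma nested_halves (a b : nat -> R) :
  a 0%nat <= b 0%nat ->
  (forall n, half_of (a n) (b n) (a (S n)) (b (S n))) ->
  exists x, forall n, a 0%nat <= a n <= x /\ x <= b n <= b 0%nat /\
                      b n - a n = (b 0%nat - a 0%nat) * (/ 2) ^ n.
Proof.
intros H0 Hs.
assert (Hlen : forall n, b n - a n = (b 0%nat - a 0%nat) * (/ 2) ^ n).
{ induction n as [|n IH]; [simpl; ring|].
  simpl. replace ((b 0%nat - a 0%nat) * (/ 2 * (/ 2) ^ n)) with ((b n - a n) / 2)
    by (rewrite IH; field).
  destruct (Hs n) as [[-> ->]|[-> ->]]; field. }
assert (Hpos : forall n, a n <= b n).
{ intros n. pose proof (Hlen n).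
  assert (0 <= (b 0%nat - a 0%nat) * (/ 2) ^ n).
  { apply Rmult_le_pos; [lra|]. apply pow_le; lra. }
  lra. }
assert (Ha : forall n, a n <= a (S n)).
{ intros n. pose proof (Hpos n). destruct (Hs n) as [[E1 E2]|[E1 E2]]; lra. }
assert (Hb : forall n, b (S n) <= b n).
{ intros n. pose proof (Hpos n). destruct (Hs n) as [[E1 E2]|[E1 E2]]; lra. }
assert (Hlim : is_lim_seq (fun n => b n - a n) 0).
{ apply is_lim_seq_ext with (fun n => (b 0%nat - a 0%nat) * (/ 2) ^ n).
  - intros n. symmetry; apply Hlen.
  - replace (Finite 0) with (Rbar_mult (b 0%nat - a 0%nat) 0)
      by (simpl; f_equal; ring).
    apply is_lim_seq_scal_l. apply is_lim_seq_geom. rewrite Rabs_pos_eq; lra. }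
destruct (ex_lim_seq_adj a b Ha Hb Hlim) as [Ea [Eb Eab]].
apply Lim_seq_correct' in Ea. apply Lim_seq_correct' in Eb.
exists (real (Lim_seq a)). intros n. repeat split.
- induction n as [|n IH]; [lra|]. specialize (Ha n); lra.
- apply (is_lim_seq_incr_compare a _ Ea Ha).
- rewrite Eab. apply (is_lim_seq_decr_compare b _ Eb Hb).
- induction n as [|n IH]; [lra|]. specialize (Hb n); lra.
- apply Hlen.
Qed.

(** Bisection as an induction principle: if the property failed for the rectangle it
    would fail for one of the four quarters, and so on; the rectangles obtained shrink
    to a point, where the local hypothesis contradicts the failure. *)
Lemma bisection_2d (P : R -> R -> R -> R -> Prop) (a b c d : R) :
  a <= b -> c <= d ->
  (forall a b c d, a <= b -> c <= d ->
     (forall a' b' c' d', half_of a b a' b' -> half_of c d c' d' -> P a' b' c' d') ->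
     P a b c d) ->
  (forall x y, a <= x <= b -> c <= y <= d ->
     exists delta, 0 < delta /\
       forall a' b' c' d', a' <= x <= b' -> c' <= y <= d' ->
         b' - a' < delta -> d' - c' < delta -> P a' b' c' d') ->
  P a b c d.
Proof.
intros Hab Hcd Hjoin Hloc. apply NNPP; intros Hbad.
pose (ok := fun q : (R * R) * (R * R) =>
  fst (fst q) <= snd (fst q) /\ fst (snd q) <= snd (snd q) /\
  ~ P (fst (fst q)) (snd (fst q)) (fst (snd q)) (snd (snd q))).
pose (child := fun q q' : (R * R) * (R * R) =>
  half_of (fst (fst q)) (snd (fst q)) (fst (fst q')) (snd (fst q')) /\
  half_of (fst (snd q)) (snd (snd q)) (fst (snd q')) (snd (snd q'))).
assert (Hstep : forall q, exists q', ok q -> ok q' /\ child q q').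
{ intros [[u v] [s t]].
  destruct (classic (ok ((u, v), (s, t)))) as [Hok|Hok]; [|exists ((u, v), (s, t)); tauto].
  destruct Hok as [H1 [H2 H3]]; simpl in *.
  apply NNPP; intros Hno. apply H3. apply Hjoin; auto.
  intros u' v' s' t' Hu Hs. apply NNPP; intros HP.
  apply Hno. exists ((u', v'), (s', t')). intros _.
  split; [|now split]. split; [|split]; simpl; auto.
  - destruct Hu as [[-> ->]|[-> ->]]; lra.
  - destruct Hs as [[-> ->]|[-> ->]]; lra. }
pose (step := fun q => proj1_sig (constructive_indefinite_description _ (Hstep q))).
assert (Hst : forall q, ok q -> ok (step q) /\ child q (step q)).
{ intros q. exact (proj2_sig (constructive_indefinite_description _ (Hstep q))). }
pose (Q := fun n => Nat.iter n step ((a, b), (c, d))).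
assert (HQ : forall n, ok (Q n)).
{ induction n as [|n IH]; [now split|]. apply (Hst (Q n) IH). }
assert (HC : forall n, child (Q n) (Q (S n))).
{ intros n. apply (Hst (Q n) (HQ n)). }
destruct (nested_halves (fun n => fst (fst (Q n))) (fun n => snd (fst (Q n))))
  as [x Hx]; [exact Hab|intros n; apply HC|].
destruct (nested_halves (fun n => fst (snd (Q n))) (fun n => snd (snd (Q n))))
  as [y Hy]; [exact Hcd|intros n; apply HC|].
simpl in Hx, Hy.
destruct (Hloc x y) as [delta [Hd HP]].
{ destruct (Hx 0%nat) as [? [? _]]; simpl in *; lra. }
{ destruct (Hy 0%nat) as [? [? _]]; simpl in *; lra. }
set (K := (b - a) + (d - c) + 1).
assert (HK : 0 < K) by (unfold K; lra).
destruct (pow_lt_1_zero (/ 2)) with (y := delta / K) as [N HN].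
{ rewrite Rabs_pos_eq; lra. }
{ apply Rdiv_lt_0_compat; lra. }
specialize (HN N (le_n N)).
assert (HpN : 0 <= (/ 2) ^ N) by (apply pow_le; lra).
rewrite Rabs_pos_eq in HN by exact HpN.
apply (Rmult_lt_compat_r K) in HN; [|exact HK].
replace (delta / K * K) with delta in HN by (field; lra).
destruct (HQ N) as [_ [_ Hbad']]. apply Hbad'.
destruct (Hx N) as [Hx1 [Hx2 Hx3]]. destruct (Hy N) as [Hy1 [Hy2 Hy3]].
apply HP; try lra.
- rewrite Hx3. eapply Rle_lt_trans; [|exact HN].
  rewrite Rmult_comm. apply Rmult_le_compat_l; [exact HpN|unfold K; lra].
- rewrite Hy3. eapply Rle_lt_trans; [|exact HN].
  rewrite Rmult_comm. apply Rmult_le_compat_l; [exact HpN|unfold K; lra].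
Qed.

(** For [k = U + i V] this is the imaginary part of the integral of [k] along the
    boundary of the rectangle, traversed counterclockwise. *)
Definition flux (U V : R -> R -> R) (a b c d : R) : R :=
  RInt (fun x => V x c - V x d) a b + RInt (fun y => U b y - U a y) c d.

(** Of the two Cauchy-Riemann equations only [dU/dx = dV/dy] is recorded: it is the one
    that makes the [flux] vanish. *)
Definition cr_differentiable (U V : R -> R -> R) (x y : R) : Prop :=
  exists p q q', differentiable_pt_lim U x y p q /\ differentiable_pt_lim V x y q' p.

Lemma differentiable_pt_lim_ball U x y p q eps : 0 < eps ->
  differentiable_pt_lim U x y p q ->
  exists delta, 0 < delta /\ forall u v, Rabs (u - x) < delta -> Rabs (v - y) < delta ->
    Rabs (U u v - U x y - (p * (u - x) + q * (v - y))) <= eps * (Rabs (u - x) + Rabs (v - y)).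
Proof.
intros He H. destruct (H (mkposreal eps He)) as [d Hd].
exists d; split; [apply cond_pos|]. intros u v Hu Hv.
eapply Rle_trans; [apply (Hd u v Hu Hv)|]. simpl.
apply Rmult_le_compat_l; [lra|].
pose proof (Rabs_pos (u - x)). pose proof (Rabs_pos (v - y)).
apply Rmax_lub; lra.
Qed.

Lemma differentiable_continuous_x U x y p q :
  differentiable_pt_lim U x y p q -> continuous (fun u => U u y) x.
Proof.
intros H. apply (ex_derive_continuous (V := R_NormedModule) (fun u => U u y)). exists p.
apply is_derive_Reals.
replace p with (p * 1 + q * 0) by ring.
apply (derivable_pt_lim_comp_2d U (fun u => u) (fun _ => y)); auto.
- apply derivable_pt_lim_id.
- apply derivable_pt_lim_const.
Qed.

Lemma differentiable_continuous_y U x y p q :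
  differentiable_pt_lim U x y p q -> continuous (fun v => U x v) y.
Proof.
intros H. apply (ex_derive_continuous (V := R_NormedModule) (fun v => U x v)). exists q.
apply is_derive_Reals.
replace q with (p * 0 + q * 1) by ring.
apply (derivable_pt_lim_comp_2d U (fun _ => x) (fun v => v)); auto.
- apply derivable_pt_lim_const.
- apply derivable_pt_lim_id.
Qed.

Section Goursat.
Variables U V : R -> R -> R.
Variable s : R.
Hypothesis HUV : forall x y, x < s -> cr_differentiable U V x y.

Lemma continuous_U_y x y : x < s -> continuous (fun u => U x u) y.
Proof.
intros H. destruct (HUV x y H) as [p [q [q' [H1 H2]]]].
eapply differentiable_continuous_y; exact H1.
Qed.
Lemma continuous_V_x x y : x < s -> continuous (fun u => V u y) x.
Proof.
intros H. destruct (HUV x y H) as [p [q [q' [H1 H2]]]].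
eapply differentiable_continuous_x; exact H2.
Qed.

Lemma ex_RInt_U_y x c d : x < s -> ex_RInt (fun y => U x y) c d.
Proof. intros H. apply (ex_RInt_continuous (V := R_CompleteNormedModule)). intros; now apply continuous_U_y. Qed.

Lemma ex_RInt_V_x y a b : a < s -> b < s -> ex_RInt (fun x => V x y) a b.
Proof.
intros Ha Hb. apply (ex_RInt_continuous (V := R_CompleteNormedModule)).
intros z [_ Hz]. apply continuous_V_x. eapply Rle_lt_trans; [exact Hz|].
now apply Rmax_lub_lt.
Qed.

Lemma ex_RInt_U_diff a b c d : a < s -> b < s -> ex_RInt (fun y => U b y - U a y) c d.
Proof.
intros Ha Hb. apply (ex_RInt_minus (V := R_CompleteNormedModule)); now apply ex_RInt_U_y.
Qed.
Lemma ex_RInt_V_diff a b c d : a < s -> b < s -> ex_RInt (fun x => V x c - V x d) a b.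
Proof.
intros Ha Hb. apply (ex_RInt_minus (V := R_CompleteNormedModule)); now apply ex_RInt_V_x.
Qed.

Lemma flux_split_x a m b c d : a < s -> m < s -> b < s ->
  flux U V a b c d = flux U V a m c d + flux U V m b c d.
Proof.
intros Ha Hm Hb. unfold flux.
rewrite <- (RInt_Chasles (V := R_CompleteNormedModule) (fun x => V x c - V x d) a m b)
  by now apply ex_RInt_V_diff.
rewrite (RInt_ext (V := R_CompleteNormedModule) (fun y => U b y - U a y)
  (fun y => plus (U m y - U a y) (U b y - U m y))).
2: { intros. unfold plus; simpl. ring. }
rewrite (RInt_plus (V := R_CompleteNormedModule)) by now apply ex_RInt_U_diff.
unfold plus; simpl. ring.
Qed.

Lemma flux_split_y a b c m d : a < s -> b < s ->
  flux U V a b c d = flux U V a b c m + flux U V a b m d.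
Proof.
intros Ha Hb. unfold flux.
rewrite <- (RInt_Chasles (V := R_CompleteNormedModule) (fun y => U b y - U a y) c m d)
  by now apply ex_RInt_U_diff.
rewrite (RInt_ext (V := R_CompleteNormedModule) (fun x => V x c - V x d)
  (fun x => plus (V x c - V x m) (V x m - V x d))).
2: { intros. unfold plus; simpl. ring. }
rewrite (RInt_plus (V := R_CompleteNormedModule)) by now apply ex_RInt_V_diff.
unfold plus; simpl. ring.
Qed.

(** The flux of the affine parts of [U] and [V] is [(dU/dx - dV/dy)] times the area,
    hence zero; only the error terms of the differentials remain. *)
Lemma flux_local x y eps : x < s -> 0 < eps ->
  exists delta, 0 < delta /\ forall a b c d, b < s -> a <= x <= b -> c <= y <= d ->
    b - a < delta -> d - c < delta ->
    Rabs (flux U V a b c d) <= eps * ((b - a) + (d - c)) ^ 2.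
Proof.
intros Hx He. destruct (HUV x y Hx) as [p [q [q' [H1 H2]]]].
assert (He2 : 0 < eps / 2) by lra.
destruct (differentiable_pt_lim_ball _ _ _ _ _ _ He2 H1) as [d1 [Hd1 E1]].
destruct (differentiable_pt_lim_ball _ _ _ _ _ _ He2 H2) as [d2 [Hd2 E2]].
exists (Rmin d1 d2); split; [now apply Rmin_pos|].
intros a b c d Hb Hxab Hycd Hba Hdc.
assert (Hba1 := Rlt_le_trans _ _ _ Hba (Rmin_l _ _)).
assert (Hba2 := Rlt_le_trans _ _ _ Hba (Rmin_r _ _)).
assert (Hdc1 := Rlt_le_trans _ _ _ Hdc (Rmin_l _ _)).
assert (Hdc2 := Rlt_le_trans _ _ _ Hdc (Rmin_r _ _)).
assert (Ha : a < s) by lra.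
set (L := (b - a) + (d - c)).
assert (Hx' : forall u, a <= u <= b -> Rabs (u - x) <= b - a)
  by (intros u Hu; apply Rabs_le; lra).
assert (Hy' : forall u, c <= u <= d -> Rabs (u - y) <= d - c)
  by (intros u Hu; apply Rabs_le; lra).
assert (F1 : forall u v, a <= u <= b -> c <= v <= d ->
  Rabs (U u v - U x y - (p * (u - x) + q * (v - y))) <= eps / 2 * L).
{ intros u v Hu Hv. specialize (Hx' u Hu). specialize (Hy' v Hv).
  eapply Rle_trans; [apply E1; lra|]. apply Rmult_le_compat_l; unfold L; lra. }
assert (F2 : forall u v, a <= u <= b -> c <= v <= d ->
  Rabs (V u v - V x y - (q' * (u - x) + p * (v - y))) <= eps / 2 * L).
{ intros u v Hu Hv. specialize (Hx' u Hu). specialize (Hy' v Hv).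
  eapply Rle_trans; [apply E2; lra|]. apply Rmult_le_compat_l; unfold L; lra. }
assert (G1 : Rabs (RInt (fun u => (V u c - V u d) - (- p * (d - c))) a b) <= (b - a) * (eps * L)).
{ apply abs_RInt_le_const; [lra| |].
  - apply (ex_RInt_minus (V := R_CompleteNormedModule)); [now apply ex_RInt_V_diff|apply ex_RInt_const].
  - intros t Ht. assert (A := F2 t c Ht ltac:(lra)). assert (B := F2 t d Ht ltac:(lra)).
    apply Rabs_le_between in A. apply Rabs_le_between in B. apply Rabs_le; lra. }
assert (G2 : Rabs (RInt (fun v => (U b v - U a v) - (p * (b - a))) c d) <= (d - c) * (eps * L)).
{ apply abs_RInt_le_const; [lra| |].
  - apply (ex_RInt_minus (V := R_CompleteNormedModule)); [now apply ex_RInt_U_diff|apply ex_RInt_const].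
  - intros t Ht. assert (A := F1 b t ltac:(lra) Ht). assert (B := F1 a t ltac:(lra) Ht).
    apply Rabs_le_between in A. apply Rabs_le_between in B. apply Rabs_le; lra. }
rewrite (RInt_minus (V := R_CompleteNormedModule) (fun u => V u c - V u d) (fun _ => - p * (d - c))),
  RInt_const in G1; [|now apply ex_RInt_V_diff|apply ex_RInt_const].
rewrite (RInt_minus (V := R_CompleteNormedModule) (fun u => U b u - U a u) (fun _ => p * (b - a))),
  RInt_const in G2; [|now apply ex_RInt_U_diff|apply ex_RInt_const].
unfold minus, plus, opp, scal in G1, G2; simpl in G1, G2. unfold mult in G1, G2; simpl in G1, G2.
unfold flux.
apply Rabs_le_between in G1. apply Rabs_le_between in G2.
apply Rabs_le.
replace (eps * L ^ 2) with ((b - a) * (eps * L) + (d - c) * (eps * L)) by (unfold L; ring).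
lra.
Qed.

(** The bound [eps * (half perimeter)^2] is inherited by a rectangle from its four
    quarters, because halving the sides divides it by four; it holds locally by
    [flux_local].  As [eps] is arbitrary the flux is zero. *)
Theorem goursat a b c d : a <= b -> b < s -> c <= d -> flux U V a b c d = 0.
Proof.
intros Hab Hb Hcd.
assert (H : forall eps, 0 < eps -> Rabs (flux U V a b c d) <= eps * ((b - a) + (d - c)) ^ 2).
{ intros eps He.
  apply (bisection_2d (fun a b c d => b < s ->
     Rabs (flux U V a b c d) <= eps * ((b - a) + (d - c)) ^ 2)); auto.
  - clear a b c d Hab Hb Hcd. intros a b c d Hab Hcd Hq Hb.
    set (m := (a + b) / 2). set (n := (c + d) / 2).
    assert (Hm : m < s) by (unfold m; lra).
    rewrite (flux_split_x a m b), (flux_split_y a m c n d), (flux_split_y m b c n d) by lra.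
    assert (Q1 := Hq a m c n (or_introl (conj eq_refl eq_refl)) (or_introl (conj eq_refl eq_refl)) Hm).
    assert (Q2 := Hq a m n d (or_introl (conj eq_refl eq_refl)) (or_intror (conj eq_refl eq_refl)) Hm).
    assert (Q3 := Hq m b c n (or_intror (conj eq_refl eq_refl)) (or_introl (conj eq_refl eq_refl)) Hb).
    assert (Q4 := Hq m b n d (or_intror (conj eq_refl eq_refl)) (or_intror (conj eq_refl eq_refl)) Hb).
    assert (T1 := Rabs_triang (flux U V a m c n + flux U V a m n d) (flux U V m b c n + flux U V m b n d)).
    assert (T2 := Rabs_triang (flux U V a m c n) (flux U V a m n d)).
    assert (T3 := Rabs_triang (flux U V m b c n) (flux U V m b n d)).
    replace (b - a + (d - c)) with (2 * ((m - a) + (n - c))) by (unfold m, n; field).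
    replace (b - m) with (m - a) in * by (unfold m; field).
    replace (d - n) with (n - c) in * by (unfold n; field).
    replace (eps * (2 * (m - a + (n - c))) ^ 2) with (4 * (eps * (m - a + (n - c)) ^ 2)) by ring.
    lra.
  - intros x y Hx Hy. destruct (flux_local x y eps) as [de [Hd H]]; [lra|lra|].
    exists de; split; auto. }
apply NNPP; intros Hne.
apply Rabs_pos_lt in Hne.
set (K := (b - a + (d - c)) ^ 2) in *.
assert (HK : 0 <= K) by apply pow2_ge_0.
assert (He : 0 < Rabs (flux U V a b c d) / (2 * (K + 1))) by (apply Rdiv_lt_0_compat; lra).
specialize (H _ He).
set (F := Rabs (flux U V a b c d)) in *.
assert (F / (2 * (K + 1)) * K <= F / (2 * (K + 1)) * (K + 1)) by (apply Rmult_le_compat_l; lra).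
replace (F / (2 * (K + 1)) * (K + 1)) with (F / 2) in H0 by (field; lra).
lra.
Qed.
End Goursat.

(** * The mean value inequality at the centre of a circle *)

Lemma Im_le_Cmod c : Rabs (Im c) <= Cmod c.
Proof. eapply Rle_trans; [apply Rmax_r|apply (Rmax_Cmod c)]. Qed.

Lemma Cmod_le_Rabs (c : C) : Cmod c <= Rabs (Re c) + Rabs (Im c).
Proof.
destruct c as [x y]; simpl.
replace ((x, y) : C) with (RtoC x + Ci * RtoC y)%C
  by (unfold RtoC, Ci, Cmult, Cplus; simpl; f_equal; ring).
eapply Rle_trans; [apply Cmod_triangle|].
rewrite Cmod_mult, Cmod_Ci, !Cmod_R. lra.
Qed.

(** The error term is exactly [(u - x) * (v - y)]. *)
Lemma differentiable_pt_lim_Rmult x y : differentiable_pt_lim Rmult x y y x.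
Proof.
intros eps. exists eps. intros u v Hu Hv.
replace (u * v - x * y - (y * (u - x) + x * (v - y))) with ((u - x) * (v - y)) by ring.
rewrite Rabs_mult. apply Rmult_le_compat; try apply Rabs_pos; [lra|apply Rmax_r].
Qed.

Lemma has_cderiv_differentiable k x y l : has_cderiv k (x, y) l ->
  differentiable_pt_lim (fun u v => Re (k (u, v))) x y (Re l) (- Im l) /\
  differentiable_pt_lim (fun u v => Im (k (u, v))) x y (Im l) (Re l).
Proof.
intros H.
assert (Main : forall eps : posreal, exists delta : posreal, forall u v,
  Rabs (u - x) < delta -> Rabs (v - y) < delta ->
  Cmod (k (u, v) - k (x, y) - l * ((u, v) - (x, y))) <= eps * Rmax (Rabs (u - x)) (Rabs (v - y))).
{ intros eps. destruct (H (eps / 2)) as [d [Hd H1]]; [pose proof (cond_pos eps); lra|].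
  assert (Hd2 : 0 < d / 2) by lra.
  exists (mkposreal _ Hd2). simpl. intros u v Hu Hv.
  assert (A : Cmod ((u, v) - (x, y)) <= Rabs (u - x) + Rabs (v - y)).
  { exact (Cmod_le_Rabs ((u, v) - (x, y))%C). }
  eapply Rle_trans; [apply H1; lra|].
  replace (eps * Rmax (Rabs (u - x)) (Rabs (v - y)))
    with (eps / 2 * (2 * Rmax (Rabs (u - x)) (Rabs (v - y)))) by field.
  apply Rmult_le_compat_l; [pose proof (cond_pos eps); lra|].
  pose proof (Rmax_l (Rabs (u - x)) (Rabs (v - y))).
  pose proof (Rmax_r (Rabs (u - x)) (Rabs (v - y))). lra. }
split; intros eps; destruct (Main eps) as [d Hd]; exists d; intros u v Hu Hv;
  (eapply Rle_trans; [|apply (Hd u v Hu Hv)]).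
- eapply Rle_trans; [|apply re_le_Cmod]. right; f_equal. unfold Re, Im; simpl; ring.
- eapply Rle_trans; [|apply Im_le_Cmod]. right; f_equal. unfold Re, Im; simpl; ring.
Qed.

Definition polar (s t : R) : C := (exp s * cos t, exp s * sin t).

Lemma Cmod_polar s t : Cmod (polar s t) = exp s.
Proof.
unfold Cmod, polar; simpl.
replace (exp s * cos t * (exp s * cos t * 1) + exp s * sin t * (exp s * sin t * 1))
  with (exp s * exp s * (Rsqr (sin t) + Rsqr (cos t))) by (unfold Rsqr; ring).
rewrite sin2_cos2, Rmult_1_r. apply sqrt_square. left; apply exp_pos.
Qed.

Lemma differentiable_polar s t :
  differentiable_pt_lim (fun s t => exp s * cos t) s t (exp s * cos t) (- (exp s * sin t)) /\
  differentiable_pt_lim (fun s t => exp s * sin t) s t (exp s * sin t) (exp s * cos t).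
Proof.
assert (He : differentiable_pt_lim (fun s _ => exp s) s t (exp s) 0).
{ apply differentiable_pt_lim_proj1_0. apply derivable_pt_lim_exp. }
assert (P2 : forall f l, derivable_pt_lim f t l ->
   differentiable_pt_lim (fun _ v => f v) s t 0 l).
{ intros f l H. apply is_derive_Reals in H.
  destruct H as [_ H]. specialize (H t (fun P H => H)).
  intros eps. destruct (H eps) as [d Hd]. exists d. intros u v Hu Hv.
  specialize (Hd v Hv).
  change (Rabs (f v - f t - (v - t) * l) <= eps * Rabs (v - t)) in Hd.
  replace (f v - f t - (0 * (u - s) + l * (v - t))) with (f v - f t - (v - t) * l) by ring.
  eapply Rle_trans; [exact Hd|]. apply Rmult_le_compat_l; [left; apply cond_pos|apply Rmax_r]. }
split.
- pose proof (differentiable_pt_lim_comp Rmult (fun s _ => exp s) (fun _ t => cos t) s t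
    _ _ _ _ _ _ (differentiable_pt_lim_Rmult _ _) He (P2 _ _ (derivable_pt_lim_cos t))) as H.
  replace (exp s * cos t) with (cos t * exp s + exp s * 0) by ring.
  replace (- (exp s * sin t)) with (cos t * 0 + exp s * - sin t) by ring. exact H.
- pose proof (differentiable_pt_lim_comp Rmult (fun s _ => exp s) (fun _ t => sin t) s t
    _ _ _ _ _ _ (differentiable_pt_lim_Rmult _ _) He (P2 _ _ (derivable_pt_lim_sin t))) as H.
  replace (exp s * sin t) with (sin t * exp s + exp s * 0) by ring.
  replace (exp s * cos t) with (sin t * 0 + exp s * cos t) by ring. exact H.
Qed.

(** The exponential is its own derivative, so the chain rule multiplies the derivative
    of [k] by [polar s t]; the Cauchy-Riemann equations survive. *)
Lemma cr_differentiable_polar k s t l : has_cderiv k (polar s t) l ->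
  cr_differentiable (fun s t => Re (k (polar s t))) (fun s t => Im (k (polar s t))) s t.
Proof.
intros H. destruct (has_cderiv_differentiable _ _ _ _ H) as [H1 H2].
destruct (differentiable_polar s t) as [X Y].
pose proof (differentiable_pt_lim_comp _ _ _ _ _ _ _ _ _ _ _ H1 X Y) as HU.
pose proof (differentiable_pt_lim_comp _ _ _ _ _ _ _ _ _ _ _ H2 X Y) as HV.
exists (Re l * (exp s * cos t) + - Im l * (exp s * sin t)).
eexists. eexists. split; [exact HU|].
replace (Re l * (exp s * cos t) + - Im l * (exp s * sin t))
  with (Im l * - (exp s * sin t) + Re l * (exp s * cos t)) by ring. exact HV.
Qed.

(** The sides [t = 0] and [t = 2 * PI] of the rectangle have the same image, so their
    contributions to the flux cancel and the two vertical sides must agree. *)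
Lemma circle_integral_constant k rho s1 s2 : 0 < rho ->
  (forall z, z <> RtoC 0 -> Cmod z < rho -> exists l, has_cderiv k z l) ->
  s1 <= s2 -> s2 < ln rho ->
  RInt (fun t => Re (k (polar s1 t))) 0 (2 * PI) = RInt (fun t => Re (k (polar s2 t))) 0 (2 * PI)
  /\ ex_RInt (fun t => Re (k (polar s1 t))) 0 (2 * PI).
Proof.
intros Hr Hk H12 H2.
assert (HUV : forall s t, s < ln rho ->
  cr_differentiable (fun s t => Re (k (polar s t))) (fun s t => Im (k (polar s t))) s t).
{ intros s t Hs. destruct (Hk (polar s t)) as [l Hl].
  - apply Cmod_gt_0. rewrite Cmod_polar. apply exp_pos.
  - rewrite Cmod_polar. rewrite <- (exp_ln rho) by exact Hr. now apply exp_increasing.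
  - now apply cr_differentiable_polar with l. }
pose proof PI_RGT_0 as HPI.
pose proof (goursat _ _ _ HUV s1 s2 0 (2 * PI) H12 H2 ltac:(lra)) as G.
unfold flux in G.
rewrite (RInt_ext (V := R_CompleteNormedModule) _ (fun _ => 0)) in G.
2: { intros x _. unfold polar. rewrite cos_0, sin_0, cos_2PI, sin_2PI. apply Rminus_diag_eq. reflexivity. }
rewrite RInt_const in G.
rewrite (RInt_minus (V := R_CompleteNormedModule) (fun t => Re (k (polar s2 t)))
  (fun t => Re (k (polar s1 t)))) in G;
  try (apply (ex_RInt_U_y _ _ _ HUV); lra).
unfold scal, minus, plus, opp in G; simpl in G. unfold mult in G; simpl in G.
split; [lra|]. apply (ex_RInt_U_y _ _ _ HUV); lra.
Qed.

(** If the real part were negative at the centre, it would be negative on a small circle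
    and its integral there would be negative, whereas that integral equals the one over
    the circle of radius [r]. *)
Theorem Re_nonneg_at_centre k rho r :
  (forall z, z <> RtoC 0 -> Cmod z < rho -> exists l, has_cderiv k z l) ->
  (forall eps, 0 < eps -> exists delta, 0 < delta /\
     forall z, Cmod z < delta -> Cmod (k z - k 0) < eps) ->
  0 < r < rho ->
  (forall z, Cmod z = r -> 0 <= Re (k z)) ->
  0 <= Re (k 0).
Proof.
intros Hk Hc Hr Hpos.
apply Rnot_lt_le; intros Hneg.
destruct (Hc (- Re (k 0))) as [d [Hd H]]; [lra|].
set (m := Rmin (d / 2) r).
assert (Hm : 0 < m) by (apply Rmin_pos; lra).
destruct (circle_integral_constant k rho (ln m) (ln r)) as [E I].
- lra.
- exact Hk.
- apply ln_le; [exact Hm|apply Rmin_r].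
- apply ln_increasing; lra.
- pose proof PI_RGT_0 as HPI.
  assert (H1 : 0 <= RInt (fun t => Re (k (polar (ln r) t))) 0 (2 * PI)).
  { apply RInt_ge_0; [lra| |].
    - apply (circle_integral_constant k rho (ln r) (ln r)); [lra|exact Hk|lra|].
      apply ln_increasing; lra.
    - intros t _. apply Hpos. rewrite Cmod_polar. apply exp_ln; lra. }
  assert (H2 : RInt (fun t => Re (k (polar (ln m) t))) 0 (2 * PI) < RInt (fun t => 0) 0 (2 * PI)).
  { apply RInt_lt; [lra| | |].
    - intros; apply continuous_const.
    - intros t _. destruct (Hk (polar (ln m) t)) as [l Hl].
      + apply Cmod_gt_0. rewrite Cmod_polar. apply exp_pos.
      + rewrite Cmod_polar, exp_ln by exact Hm. unfold m.
        eapply Rle_lt_trans; [apply Rmin_r|lra].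
      + destruct (cr_differentiable_polar _ _ _ _ Hl) as [p [q [q' [D _]]]].
        exact (differentiable_continuous_y _ _ _ _ _ D).
    - intros t _. assert (Cmod (polar (ln m) t) < d).
      { rewrite Cmod_polar, exp_ln by exact Hm. unfold m.
        eapply Rle_lt_trans; [apply Rmin_l|lra]. }
      specialize (H _ H0). pose proof (re_le_Cmod (k (polar (ln m) t) - k 0)) as A.
      apply Rabs_le_between in A.
      change (Re (k (polar (ln m) t) - k 0)%C) with (Re (k (polar (ln m) t)) - Re (k 0)) in A.
      lra. }
  rewrite RInt_const in H2. unfold scal in H2; simpl in H2; unfold mult in H2; simpl in H2.
  lra.
Qed.

(** * Coefficients of functions with positive real part *)

Definition Csum (u : nat -> C) (n : nat) : C := @sum_n C_AbelianMonoid u n.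

Lemma Csum_S (u : nat -> C) n : Csum u (S n) = (Csum u n + u (S n))%C.
Proof. exact (sum_Sn u n). Qed.

Lemma Csum_O (u : nat -> C) : Csum u 0 = u 0%nat.
Proof. exact (sum_O u). Qed.

Lemma has_cderiv_sum (u : nat -> C -> C) z n :
  (forall m, exists l, has_cderiv (u m) z l) ->
  exists l, has_cderiv (fun x => Csum (fun m => u m x) n) z l.
Proof.
intros H. induction n as [|n [l IH]].
- destruct (H 0%nat) as [l Hl]. exists l.
  apply (has_cderiv_ext_loc (u 0%nat) _ z l 1); [lra| |exact Hl].
  intros y _. now rewrite Csum_O.
- destruct (H (S n)) as [l' Hl']. exists (l + l')%C.
  apply (has_cderiv_ext_loc (fun x => Csum (fun m => u m x) n + u (S n) x)%C _ z _ 1); [lra| |].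
  + intros y _. now rewrite Csum_S.
  + now apply has_cderiv_plus.
Qed.

Lemma Cmult_conj_Cmod z : (z * Cconj z)%C = RtoC (Cmod z ^ 2).
Proof. symmetry. apply Cmod2_conj. Qed.

(** On the circle of [z] the conjugate of [z] is [|z|^2 / z], so [z^N] times the
    conjugate of a polynomial of degree at most [N] agrees with a polynomial. *)
Lemma reflected_sum (c : nat -> C) (z : C) (N n : nat) : (n <= N)%nat ->
  Csum (fun m => Cconj (c m) * RtoC (Cmod z ^ 2) ^ m * z ^ (N - m))%C n
  = (z ^ N * Cconj (Csum (fun m => c m * z ^ m) n))%C.
Proof.
assert (T : forall m, (m <= N)%nat ->
  (Cconj (c m) * RtoC (Cmod z ^ 2) ^ m * z ^ (N - m) = z ^ N * Cconj (c m * z ^ m))%C).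
{ intros m Hm. rewrite <- Cmult_conj_Cmod, Cpow_mult_l, Cmult_conj, Cpow_conj.
  replace (z ^ N)%C with (z ^ m * z ^ (N - m))%C by (rewrite <- Cpow_add_r; f_equal; lia).
  ring. }
induction n as [|n IH]; intros Hn.
- rewrite !Csum_O. now apply T.
- rewrite !Csum_S, IH, T by lia. rewrite Cplus_conj. ring.
Qed.

Lemma Cpow_0_S n : (0 ^ S n)%C = RtoC 0.
Proof. simpl. ring. Qed.

Lemma reflected_sum_0 (c : nat -> C) (a : C) (N n : nat) : (n < N)%nat ->
  Csum (fun m => Cconj (c m) * a ^ m * 0 ^ (N - m))%C n = RtoC 0.
Proof.
induction n as [|n IH]; intros Hn.
- rewrite Csum_O. replace (N - 0)%nat with (S (N - 1)) by lia. rewrite Cpow_0_S. ring.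
- rewrite Csum_S, IH by lia. replace (N - S n)%nat with (S (N - n - 2)) by lia.
  rewrite Cpow_0_S. ring.
Qed.

Definition continuous_at_0 (h : C -> C) : Prop :=
  forall eps, 0 < eps -> exists delta, 0 < delta /\
    forall z, Cmod z < delta -> Cmod (h z - h 0) < eps.

Lemma Cminus_0_r (z : C) : (z - 0)%C = z.
Proof. ring. Qed.

Lemma continuous_at_0_plus_scal f g l c : has_cderiv f 0 l -> continuous_at_0 g ->
  continuous_at_0 (fun z => f z + c * g z)%C.
Proof.
intros Hf Hg eps He.
pose proof (Cmod_ge_0 c) as Hc.
destruct (has_cderiv_continuous _ _ _ Hf (eps / 2)) as [d1 [Hd1 H1]]; [lra|].
destruct (Hg (eps / 2 / (Cmod c + 1))) as [d2 [Hd2 H2]].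
{ apply Rdiv_lt_0_compat; lra. }
exists (Rmin d1 d2); split; [now apply Rmin_pos|]. intros z Hz.
assert (Hz1 := Rlt_le_trans _ _ _ Hz (Rmin_l _ _)).
assert (Hz2 := Rlt_le_trans _ _ _ Hz (Rmin_r _ _)).
replace (f z + c * g z - (f 0 + c * g 0))%C with ((f z - f 0) + c * (g z - g 0))%C by ring.
eapply Rle_lt_trans; [apply Cmod_triangle|]. rewrite Cmod_mult.
specialize (H2 z Hz2). rewrite <- (Cminus_0_r z) in Hz1. specialize (H1 z Hz1).
assert (Cmod c * Cmod (g z - g 0) <= (Cmod c + 1) * (eps / 2 / (Cmod c + 1))).
{ apply Rmult_le_compat; try apply Cmod_ge_0; lra. }
replace ((Cmod c + 1) * (eps / 2 / (Cmod c + 1))) with (eps / 2) in H by (field; lra).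
lra.
Qed.

Lemma le_of_le_mult_pow x c n : (forall r, 0 < r < 1 -> x * r ^ n <= c) -> x <= c.
Proof.
intros H. apply Rnot_lt_le; intros Hlt.
destruct (Rle_lt_dec x 0) as [Hx|Hx].
{ specialize (H (1 / 2) ltac:(lra)).
  assert ((1 / 2) ^ n <= 1) by (rewrite <- (pow1 n) at 2; apply pow_incr; lra).
  pose proof (Rmult_le_compat_neg_l _ _ _ Hx H0). lra. }
assert (L : is_lim_seq (fun k => x * (1 - (/ 2) ^ S k) ^ n) x).
{ replace (Finite x) with (Rbar_mult (Finite x) (Finite ((1 - 0) ^ n))).
  2: { simpl. rewrite Rminus_0_r, pow1. f_equal; ring. }
  apply (is_lim_seq_scal_l (fun k => (1 - (/ 2) ^ S k) ^ n) x ((1 - 0) ^ n)).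
  apply (is_lim_seq_continuous (fun y => y ^ n) (fun k => 1 - (/ 2) ^ S k) (1 - 0)).
  - apply derivable_continuous_pt. apply derivable_pt_pow.
  - apply is_lim_seq_minus'; [apply is_lim_seq_const|].
    apply (is_lim_seq_incr_1 (fun k => (/ 2) ^ k)). apply is_lim_seq_geom.
    rewrite Rabs_pos_eq; lra. }
assert (Rbar_le x c).
{ apply (is_lim_seq_le (fun k => x * (1 - (/ 2) ^ S k) ^ n) (fun _ => c)).
  - intros k. apply H.
    assert (0 < (/ 2) ^ S k) by (apply pow_lt; lra).
    assert ((/ 2) ^ S k < 1).
    { apply pow_lt_1_compat; [lra|lia]. }
    lra.
  - exact L.
  - apply is_lim_seq_const. }
simpl in H0. lra.
Qed.

Lemma Re_mult_conj_plus (a b p : C) :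
  Re (2 * p + (p * (a + Cconj a)))%C = 2 * Re p * (1 + Re a).
Proof. unfold Re, Cconj; simpl. ring. Qed.

(** Testing [p] against the nonnegative kernel [1 + Re (eta * (r / z)^N)] on the circle
    of radius [r] gives [0 <= 2 + Re (eta * r^N * S 0)], and [eta] can be chosen so that
    the last term is [- r^N * |S 0|].  To use [Re_nonneg_at_centre] the integrand has
    to be the real part of a function that is continuous at 0: the part of
    [eta * (r / z)^N * p] with negative powers of [z] is replaced by a polynomial with the
    same real part on the circle ([reflected_sum]). *)
Theorem caratheodory_coefficient (p S : C -> C) (c : nat -> C) (n : nat) :
  (forall z, in_disk z -> exists l, has_cderiv p z l) ->
  (forall z, in_disk z -> 0 <= Re (p z)) ->
  p 0 = RtoC 1 ->
  (forall z, in_disk z -> p z = Csum (fun m => c m * z ^ m) n + z ^ (n + 1) * S z)%C ->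
  continuous_at_0 S ->
  Cmod (S 0) <= 2.
Proof.
intros Hp Hre Hp0 HS Hcont.
set (N := (n + 1)%nat).
set (cN := S 0).
destruct (Req_dec (Cmod cN) 0) as [H0|H0]; [rewrite H0; lra|].
apply (le_of_le_mult_pow _ _ N). intros r Hr.
(* the unimodular number that turns [cN] into [- |cN|] *)
set (eta := (- (Cconj cN / Cmod cN))%C).
assert (Heta : Cmod eta = 1).
{ unfold eta. rewrite Cmod_opp, Cmod_div, Cmod_conj, Cmod_R, Rabs_pos_eq.
  - now field.
  - apply Cmod_ge_0.
  - intros E. apply H0. now apply RtoC_inj in E. }
assert (Hetac : (eta * cN)%C = RtoC (- Cmod cN)).
{ unfold eta. replace (- (Cconj cN / Cmod cN) * cN)%C with (- (cN * Cconj cN / Cmod cN))%C.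
  - rewrite Cmult_conj_Cmod. rewrite <- RtoC_div, <- RtoC_opp by exact H0. f_equal. now field.
  - field. intros E. apply H0. now apply RtoC_inj in E. }
assert (HrC : RtoC r <> RtoC 0) by (intros E; apply RtoC_inj in E; lra).
assert (HrN : (RtoC r ^ N)%C <> RtoC 0) by now apply Cpow_nz.
set (Q := fun z : C => Csum (fun m => Cconj (c m) * RtoC (r ^ 2) ^ m * z ^ (N - m))%C n).
(* the part of the integrand that is differentiable at 0 by construction *)
set (k1 := fun z : C => (p z * (2 + Cconj eta / r ^ N * z ^ N) + Cconj eta / r ^ N * Q z)%C).
set (k := fun z : C => (k1 z + (eta * r ^ N) * S z)%C).
assert (k1_deriv : forall z, in_disk z -> exists l, has_cderiv k1 z l).
{ intros z Hz. destruct (Hp z Hz) as [l Hl].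
  destruct (has_cderiv_pow N z) as [lN HlN].
  destruct (has_cderiv_sum (fun m z => Cconj (c m) * RtoC (r ^ 2) ^ m * z ^ (N - m))%C z n) as [lQ HlQ].
  { intros m. destruct (has_cderiv_pow (N - m) z) as [lm Hm]. eexists.
    apply has_cderiv_scal. exact Hm. }
  eexists. apply has_cderiv_plus.
  - apply has_cderiv_mult; [exact Hl|]. apply has_cderiv_plus; [apply has_cderiv_const|].
    apply has_cderiv_scal. exact HlN.
  - apply has_cderiv_scal. exact HlQ. }
assert (D0 : in_disk 0) by (unfold in_disk; rewrite Cmod_0; lra).
assert (H : 0 <= Re (k 0)).
{ apply (Re_nonneg_at_centre k 1 r).
  - intros z Hz0 Hz. destruct (k1_deriv z Hz) as [l1 Hl1].
    assert (exists l, has_cderiv S z l) as [lS HlS].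
    { destruct (Hp z Hz) as [l Hl].
      destruct (has_cderiv_pow N z) as [lN HlN].
      destruct (has_cderiv_sum (fun m z => c m * z ^ m)%C z n) as [lT HlT].
      { intros m. destruct (has_cderiv_pow m z) as [lm Hm]. eexists.
        apply has_cderiv_scal. exact Hm. }
      eexists.
      apply (has_cderiv_ext_loc (fun y => (p y + (- (1)) * Csum (fun m => c m * y ^ m)%C n) * / y ^ N)%C
        _ _ _ (Rmin (Cmod z / 2) (1 - Cmod z))).
      - apply Rmin_pos; [|unfold in_disk in Hz; lra].
        assert (0 < Cmod z) by now apply Cmod_gt_0. lra.
      - intros y Hy.
        assert (Hy1 := Rlt_le_trans _ _ _ Hy (Rmin_l _ _)).
        assert (Hy2 := Rlt_le_trans _ _ _ Hy (Rmin_r _ _)).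
        apply Cminus_lower in Hy1; [|exact Hz0].
        pose proof (Cmod_ge_0 z).
        assert (y <> RtoC 0) by (apply Cmod_gt_0; lra).
        rewrite (HS y).
        + fold N. field. now apply Cpow_nz.
        + unfold in_disk. pose proof (Cmod_triangle z (y - z)) as T.
          replace (z + (y - z))%C with y in T by ring. lra.
      - apply has_cderiv_mult.
        + apply has_cderiv_plus; [exact Hl|]. apply has_cderiv_scal. exact HlT.
        + apply has_cderiv_inv; [now apply Cpow_nz|exact HlN]. }
    eexists. apply has_cderiv_plus; [exact Hl1|]. apply has_cderiv_scal. exact HlS.
  - destruct (k1_deriv 0 D0) as [l Hl]. exact (continuous_at_0_plus_scal _ _ _ _ Hl Hcont).
  - lra.
  - intros z Hz.
    assert (Hzd : in_disk z) by (unfold in_disk; lra).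
    assert (Hz0 : z <> RtoC 0) by (apply Cmod_gt_0; lra).
    assert (HQ : Q z = (z ^ N * Cconj (Csum (fun m => c m * z ^ m) n))%C).
    { unfold Q. rewrite <- Hz. apply reflected_sum. unfold N; lia. }
    (* on the circle [Re (k z) = 2 Re (p z) (1 + Re a)] with [|a| = 1] *)
    set (a := (eta * r ^ N / z ^ N)%C).
    assert (Ha : (Cconj eta / r ^ N * z ^ N)%C = Cconj a).
    { unfold a. rewrite Cdiv_conj by now apply Cpow_nz.
      rewrite Cmult_conj, <- RtoC_pow, Cpow_conj.
      assert (Hrr : (RtoC r ^ N * RtoC r ^ N = z ^ N * Cconj z ^ N)%C).
      { rewrite <- !Cpow_mult_l. f_equal. rewrite Cmult_conj_Cmod, Hz, RtoC_pow. ring. }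
      replace (Cconj (RtoC (r ^ N))) with (RtoC r ^ N)%C
        by (rewrite <- RtoC_pow; unfold Cconj, RtoC; simpl; f_equal; ring).
      assert (Hcz : (Cconj z ^ N)%C <> RtoC 0).
      { apply Cpow_nz. apply Cmod_gt_0. rewrite Cmod_conj. lra. }
      rewrite RtoC_pow.
      replace (z ^ N)%C with (RtoC r ^ N * RtoC r ^ N / Cconj z ^ N)%C
        by (rewrite Hrr; field; exact Hcz).
      field. split; assumption. }
    assert (HRe : Re (k z) = Re (2 * p z + p z * (a + Cconj a))%C).
    { unfold k, k1. rewrite HQ.
      set (T := Csum (fun m => c m * z ^ m)%C n) in *.
      replace (Cconj eta / r ^ N * (z ^ N * Cconj T))%C with (Cconj a * Cconj T)%C
        by (rewrite <- Ha; field; exact HrN).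
      rewrite Ha. rewrite <- Cmult_conj.
      replace (eta * r ^ N * S z)%C with (a * (z ^ N * S z))%C
        by (unfold a; field; now apply Cpow_nz).
      replace (z ^ N * S z)%C with (p z - T)%C by (rewrite (HS z Hzd); unfold T, N; ring).
      unfold Re, Cconj; simpl. ring. }
    rewrite HRe, Re_mult_conj_plus by exact a.
    assert (Hma : Cmod a = 1).
    { unfold a. rewrite Cmod_div, Cmod_mult, Heta, !Cmod_pow, Hz, Cmod_R, Rabs_pos_eq.
      - field. apply pow_nonzero; lra.
      - lra.
      - now apply Cpow_nz. }
    pose proof (re_le_Cmod a) as Hra. apply Rabs_le_between in Hra.
    specialize (Hre z Hzd).
    apply Rmult_le_pos; lra. }
unfold k, k1, Q in H. rewrite reflected_sum_0 in H by (unfold N; lia).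
rewrite Hp0 in H. fold cN in H.
replace (0 ^ N)%C with (RtoC 0) in H by (unfold N; rewrite Nat.add_1_r; symmetry; apply Cpow_0_S).
replace (1 * (2 + Cconj eta / r ^ N * 0) + Cconj eta / r ^ N * 0 + eta * r ^ N * cN)%C
  with (2 + (eta * cN) * r ^ N)%C in H by (field; exact HrN).
rewrite Hetac, <- RtoC_pow, <- RtoC_mult, <- RtoC_plus in H. simpl in H. lra.
Qed.

(** * Complex power series *)

Definition Cseries (u : nat -> C) (l : C) : Prop :=
  @is_series C_AbsRing C_NormedModule u l.

Lemma Cseries_unique u l m : Cseries u l -> Cseries u m -> l = m.
Proof.
apply (filterlim_locally_unique (V := C_NormedModule) (F := eventually)).
Qed.

Lemma Cseries_bound u l (s : nat -> R) S :
  Cseries u l -> is_series s S -> (forall n, Cmod (u n) <= s n) -> Cmod l <= S.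
Proof.
intros Hu Hs Hle.
assert (Rbar_le (Cmod l) S); [|exact H].
apply (is_lim_seq_le (fun n => Cmod (Csum u n)) (sum_n s)).
- intros n. eapply Rle_trans.
  + apply (norm_sum_n_m (V := C_NormedModule) u 0 n).
  + apply sum_n_m_le. exact Hle.
- apply (filterlim_comp _ _ _ (Csum u) (@norm C_AbsRing C_NormedModule) eventually (locally (T := C_NormedModule) l)).
  + exact Hu.
  + apply (filterlim_norm (V := C_NormedModule)).
- exact Hs.
Qed.

Lemma is_series_geom_half M : is_series (fun n => M * (/ 2) ^ n) (2 * M).
Proof.
replace (2 * M) with (scal M (/ (1 - / 2))).
- apply (is_series_scal (V := R_NormedModule) M (fun n => (/ 2) ^ n)). apply is_series_geom.
  rewrite Rabs_pos_eq; lra.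
- unfold scal; simpl; unfold mult; simpl. field.
Qed.

Lemma Cseries_exists u M : (forall n, Cmod (u n) <= M * (/ 2) ^ n) -> exists l, Cseries u l.
Proof.
intros H.
apply (ex_series_le (V := C_CompleteNormedModule) u (fun n => M * (/ 2) ^ n)).
- exact H.
- eexists. apply is_series_geom_half.
Qed.

Lemma Cseries_decr_1 u l : Cseries (fun n => u (S n)) l -> Cseries u (u 0%nat + l)%C.
Proof.
intros H. apply (is_series_decr_1 (V := C_NormedModule)).
replace (plus _ _) with l; [exact H|].
change (l = (u 0%nat + l) + - u 0%nat)%C. ring.
Qed.

Lemma Cseries_scal c u l : Cseries u l -> Cseries (fun n => c * u n)%C (c * l)%C.
Proof. exact (is_series_scal (V := C_NormedModule) c u l). Qed.

Lemma Cseries_minus u v l m : Cseries u l -> Cseries v m ->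
  Cseries (fun n => u n - v n)%C (l - m)%C.
Proof.
intros Hu Hv.
apply (is_series_plus (V := C_NormedModule) u (fun n => - v n)%C l (- m)%C Hu).
exact (is_series_opp (V := C_NormedModule) v m Hv).
Qed.

Lemma Cseries_ext u v l : (forall n, u n = v n) -> Cseries u l -> Cseries v l.
Proof. exact (is_series_ext (V := C_NormedModule) u v l). Qed.

(** A total function: its value is meaningful where the series converges. *)
Definition psum (a : nat -> C) (z : C) : C :=
  epsilon (inhabits (RtoC 0)) (Cseries (fun n => a n * z ^ n)%C).

Definition geom_bounded (a : nat -> C) (M rho : R) : Prop :=
  forall n, Cmod (a n) <= M * rho ^ n.

Lemma geom_bounded_nonneg a M rho : geom_bounded a M rho -> 0 <= M.
Proof. intros H. specialize (H 0%nat). pose proof (Cmod_ge_0 (a 0%nat)). simpl in H. lra. Qed.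

Lemma geom_term_bound a M rho z n : 0 < rho -> geom_bounded a M rho -> Cmod z * rho <= / 2 ->
  Cmod (a n * z ^ n) <= M * (/ 2) ^ n.
Proof.
intros Hr Ha Hz. pose proof (geom_bounded_nonneg _ _ _ Ha) as HM.
rewrite Cmod_mult, Cmod_pow.
apply Rle_trans with (M * rho ^ n * Cmod z ^ n).
- apply Rmult_le_compat_r; [apply pow_le, Cmod_ge_0|apply Ha].
- rewrite Rmult_assoc, <- Rpow_mult_distr, (Rmult_comm rho).
  apply Rmult_le_compat_l; [exact HM|]. apply pow_incr. split; [|exact Hz].
  apply Rmult_le_pos; [apply Cmod_ge_0|lra].
Qed.

Lemma psum_unique a z l : Cseries (fun n => a n * z ^ n)%C l -> psum a z = l.
Proof.
intros H. eapply Cseries_unique; [|exact H].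
unfold psum. apply epsilon_spec. now exists l.
Qed.

Lemma psum_correct a M rho z : 0 < rho -> geom_bounded a M rho -> Cmod z * rho <= / 2 ->
  Cseries (fun n => a n * z ^ n)%C (psum a z).
Proof.
intros Hr Ha Hz. unfold psum. apply epsilon_spec.
apply (Cseries_exists _ M). intros n. now apply (geom_term_bound a M rho).
Qed.

Lemma psum_bound a M rho z : 0 < rho -> geom_bounded a M rho -> Cmod z * rho <= / 2 ->
  Cmod (psum a z) <= 2 * M.
Proof.
intros Hr Ha Hz. eapply Cseries_bound.
- now apply (psum_correct a M rho).
- apply is_series_geom_half.
- intros n. now apply (geom_term_bound a M rho).
Qed.

Definition shift (a : nat -> C) (n : nat) : C := a (S n).

Lemma geom_bounded_shift a M rho : geom_bounded a M rho -> geom_bounded (shift a) (M * rho) rho.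
Proof. intros H n. unfold shift. rewrite Rmult_assoc. exact (H (S n)). Qed.

Lemma psum_shift a M rho z : 0 < rho -> geom_bounded a M rho -> Cmod z * rho <= / 2 ->
  psum a z = (a 0%nat + z * psum (shift a) z)%C.
Proof.
intros Hr Ha Hz. apply psum_unique.
replace (a 0%nat + z * psum (shift a) z)%C with (a 0%nat * z ^ 0 + z * psum (shift a) z)%C
  by (simpl; ring).
apply (Cseries_decr_1 (fun n => a n * z ^ n)%C).
apply (Cseries_ext (fun n => z * (shift a n * z ^ n))%C).
- intros n. unfold shift. simpl. ring.
- apply Cseries_scal. apply (psum_correct _ (M * rho) rho); auto.
  now apply geom_bounded_shift.
Qed.

Definition dcoef (a : nat -> C) (n : nat) : C := (INR (S n) * a (S n))%C.

Lemma INR_S_le_pow2 n : INR (S n) <= 2 ^ n.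
Proof.
induction n as [|n IH]; [simpl; lra|].
rewrite S_INR. pose proof (pow_R1_Rle 2 n ltac:(lra)). simpl (2 ^ S n). lra.
Qed.

Lemma geom_bounded_dcoef a M rho : 0 < rho -> geom_bounded a M rho ->
  geom_bounded (dcoef a) (M * rho) (2 * rho).
Proof.
intros Hr H n. unfold dcoef. rewrite Cmod_mult, Cmod_R, Rabs_pos_eq by apply pos_INR.
apply Rle_trans with (2 ^ n * (M * rho ^ S n)).
- apply Rmult_le_compat; [apply pos_INR|apply Cmod_ge_0|apply INR_S_le_pow2|apply H].
- rewrite Rpow_mult_distr. simpl. right; ring.
Qed.

(** [dpow z n] is [n * z^(n-1)], in the form suited to induction on [n]. *)
Fixpoint dpow (z : C) (n : nat) : C :=
  match n with O => 0 | S m => z ^ m + z * dpow z m end.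

Lemma dpow_S z n : dpow z (S n) = (INR (S n) * z ^ n)%C.
Proof.
induction n as [|n IH].
- simpl. ring.
- change (dpow z (S (S n))) with (z ^ S n + z * dpow z (S n))%C.
  rewrite IH, (S_INR (S n)), RtoC_plus, Cpow_S. ring.
Qed.

Lemma dpow_bound z s n : 0 < s -> Cmod z <= s -> Cmod (dpow z n) <= (2 * s) ^ n / s.
Proof.
intros Hs Hz. induction n as [|n IH].
- simpl. rewrite Cmod_0. unfold Rdiv. rewrite Rmult_1_l. left. now apply Rinv_0_lt_compat.
- simpl. eapply Rle_trans; [apply Cmod_triangle|]. rewrite Cmod_mult, Cmod_pow.
  apply Rle_trans with (s ^ n + s * ((2 * s) ^ n / s)).
  + apply Rplus_le_compat; [apply pow_incr; split; [apply Cmod_ge_0|exact Hz]|].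
    apply Rmult_le_compat; try apply Cmod_ge_0; auto.
  + replace (s * ((2 * s) ^ n / s)) with ((2 * s) ^ n) by (field; lra).
    replace (2 * s * (2 * s) ^ n / s) with ((2 * s) ^ n + (2 * s) ^ n) by (field; lra).
    apply Rplus_le_compat_r. apply pow_incr; lra.
Qed.

(** With [e_n] the remainder on the left, [e_(n+1) = y * e_n + dpow z n * (y - z)^2]. *)
Lemma pow_remainder_bound y z s n : 0 < s -> Cmod z <= s -> Cmod y <= s ->
  Cmod (y ^ n - z ^ n - dpow z n * (y - z)) <= Cmod (y - z) ^ 2 * ((2 * s) ^ n / s ^ 2).
Proof.
intros Hs Hz Hy. set (h := Cmod (y - z)). assert (Hh : 0 <= h) by apply Cmod_ge_0.
induction n as [|n IH].
- simpl dpow. replace (y ^ 0 - z ^ 0 - 0 * (y - z))%C with (RtoC 0) by (simpl; ring).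
  rewrite Cmod_0. apply Rmult_le_pos; [apply pow2_ge_0|].
  apply Rmult_le_pos; [simpl; lra|]. left. apply Rinv_0_lt_compat. apply pow_lt; lra.
- replace (y ^ S n - z ^ S n - dpow z (S n) * (y - z))%C
    with (y * (y ^ n - z ^ n - dpow z n * (y - z)) + dpow z n * ((y - z) * (y - z)))%C
    by (simpl; ring).
  eapply Rle_trans; [apply Cmod_triangle|]. rewrite !Cmod_mult. fold h.
  apply Rle_trans with (s * (h ^ 2 * ((2 * s) ^ n / s ^ 2)) + (2 * s) ^ n / s * (h * h)).
  + apply Rplus_le_compat.
    * apply Rmult_le_compat; try apply Cmod_ge_0; auto.
    * apply Rmult_le_compat_r; [now apply Rmult_le_pos|]. now apply dpow_bound.
  + right. simpl. field. lra.
Qed.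

(** The difference quotient error is the sum of [a n] times the remainders of
    [pow_remainder_bound], a series dominated by a geometric one times [|y - z|^2]. *)
Theorem psum_derivative a M rho z : 0 < rho -> geom_bounded a M rho ->
  Cmod z * (4 * rho) < 1 -> has_cderiv (psum a) z (psum (dcoef a) z).
Proof.
intros Hr Ha Hz eps He.
pose proof (geom_bounded_nonneg _ _ _ Ha) as HM.
(* with [2 * s * rho = 1/2] the dominating series has ratio one half *)
set (s := / (4 * rho)).
assert (Hs : 0 < s) by (apply Rinv_0_lt_compat; lra).
assert (Hsr : s * rho = / 4) by (unfold s; field; lra).
assert (Hzs : Cmod z < s).
{ apply Rmult_lt_reg_r with (4 * rho); [lra|]. unfold s. rewrite Rinv_l; lra. }
set (K := 2 * (M / s ^ 2)).
assert (HK : 0 <= K).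
{ apply Rmult_le_pos; [lra|]. apply Rmult_le_pos; [lra|]. left. apply Rinv_0_lt_compat. apply pow_lt; lra. }
exists (Rmin (s - Cmod z) (eps / (K + 1))). split.
{ apply Rmin_pos; [lra|]. apply Rdiv_lt_0_compat; lra. }
intros y Hy.
assert (Hy1 := Rlt_le_trans _ _ _ Hy (Rmin_l _ _)).
assert (Hy2 := Rlt_le_trans _ _ _ Hy (Rmin_r _ _)).
assert (Hys : Cmod y < s).
{ pose proof (Cmod_triangle z (y - z)) as T. replace (z + (y - z))%C with y in T by ring. lra. }
assert (Hsmall : forall x, Cmod x < s -> Cmod x * rho <= / 2).
{ intros x Hx. apply Rle_trans with (s * rho); [|lra]. apply Rmult_le_compat_r; lra. }
assert (Hd : Cseries (fun n => a n * dpow z n)%C (psum (dcoef a) z)).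
{ replace (psum (dcoef a) z) with (a 0%nat * dpow z 0 + psum (dcoef a) z)%C by (simpl; ring).
  apply (Cseries_decr_1 (fun n => a n * dpow z n)%C).
  apply (Cseries_ext (fun n => dcoef a n * z ^ n)%C).
  - intros n. rewrite dpow_S. unfold dcoef. ring.
  - apply (psum_correct _ (M * rho) (2 * rho)); [lra|now apply geom_bounded_dcoef|].
    assert (Cmod z * rho <= s * rho) by (apply Rmult_le_compat_r; lra). lra. }
assert (Hsum : Cseries (fun n => a n * (y ^ n - z ^ n - dpow z n * (y - z)))%C
   (psum a y - psum a z - psum (dcoef a) z * (y - z))%C).
{ apply (Cseries_ext (fun n => (a n * y ^ n - a n * z ^ n) - (y - z) * (a n * dpow z n))%C).
  - intros n. ring.
  - rewrite (Cmult_comm (psum (dcoef a) z)).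
    apply Cseries_minus; [apply Cseries_minus|].
    + apply (psum_correct a M rho); auto.
    + apply (psum_correct a M rho); auto.
    + now apply Cseries_scal. }
set (h := Cmod (y - z)) in *. assert (Hh : 0 <= h) by apply Cmod_ge_0.
apply Rle_trans with (2 * (M / s ^ 2 * h ^ 2)).
- apply (Cseries_bound _ _ _ _ Hsum (is_series_geom_half _)).
  intros n. rewrite Cmod_mult.
  apply Rle_trans with (M * rho ^ n * (h ^ 2 * ((2 * s) ^ n / s ^ 2))).
  + apply Rmult_le_compat; try apply Cmod_ge_0; [apply Ha|].
    apply pow_remainder_bound; lra.
  + right.
    replace (/ 2) with (rho * (2 * s)) by lra. rewrite (Rpow_mult_distr rho (2 * s)). field. lra.
- replace (2 * (M / s ^ 2 * h ^ 2)) with (K * h * h) by (unfold K; field; lra).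
  apply Rmult_le_compat_r; [exact Hh|].
  apply Rle_trans with ((K + 1) * (eps / (K + 1))); [|right; field; lra].
  apply Rmult_le_compat; lra.
Qed.

(** Consecutive partial sums are both close to the limit. *)
Lemma Cseries_terms_bounded u l : Cseries u l -> exists M, forall n, Cmod (u n) <= M.
Proof.
intros H.
assert (B : forall N, exists M, forall n, (n <= N)%nat -> Cmod (u n) <= M).
{ induction N as [|N [M IH]].
  - exists (Cmod (u 0%nat)). intros n Hn. replace n with 0%nat by lia. lra.
  - exists (Rmax M (Cmod (u (S N)))). intros n Hn.
    destruct (Nat.eq_dec n (S N)) as [->|Hne]; [apply Rmax_r|].
    eapply Rle_trans; [apply IH; lia|apply Rmax_l]. }
assert (L : is_lim_seq (fun n => Cmod (Csum u n)) (Cmod l)).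
{ apply (filterlim_comp _ _ _ (Csum u) (@norm C_AbsRing C_NormedModule) eventually (locally (T := C_NormedModule) l)).
  + exact H.
  + apply (filterlim_norm (V := C_NormedModule)). }
apply is_lim_seq_spec in L. destruct (L (mkposreal 1 Rlt_0_1)) as [N HN]. simpl in HN.
destruct (B (S N)) as [M HM].
exists (Rmax M (2 * (Cmod l + 1))). intros n.
destruct (Nat.le_gt_cases n (S N)) as [Hn|Hn].
- eapply Rle_trans; [apply HM; exact Hn|apply Rmax_l].
- eapply Rle_trans; [|apply Rmax_r].
  destruct n as [|n]; [lia|].
  assert (A1 := HN n ltac:(lia)). assert (A2 := HN (S n) ltac:(lia)).
  apply Rabs_lt_between in A1. apply Rabs_lt_between in A2.
  replace (u (S n)) with (Csum u (S n) + - Csum u n)%C by (rewrite Csum_S; ring).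
  eapply Rle_trans; [apply Cmod_triangle|]. rewrite Cmod_opp. lra.
Qed.

(** Convergence at [1/2] bounds [a n] by a multiple of [2^n]. *)
Lemma taylor_psum a f : taylor a f ->
  (exists M, geom_bounded a M 2) /\ forall z, in_disk z -> f z = psum a z.
Proof.
intros H.
assert (E : forall z, in_disk z -> Cseries (fun n => a n * z ^ n)%C (f z)).
{ intros z Hz. apply (Cseries_ext (fun k => scal (pow_n (K := C_AbsRing) z k) (a k)));
    [|exact (H z Hz)].
  intros n. change (pow_n (K := C_AbsRing) z n * a n = a n * z ^ n)%C.
  apply Cmult_comm. }
split.
- destruct (Cseries_terms_bounded _ _ (E (RtoC (/ 2)) ltac:(unfold in_disk; rewrite Cmod_R, Rabs_pos_eq; lra)))
    as [M HM].
  exists M. intros n. specialize (HM n). rewrite Cmod_mult, Cmod_pow, Cmod_R, Rabs_pos_eq in HM by lra.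
  apply Rmult_le_reg_r with ((/ 2) ^ n); [apply pow_lt; lra|].
  rewrite Rmult_assoc, <- Rpow_mult_distr. replace (2 * / 2) with 1 by lra. rewrite pow1. lra.
- intros z Hz. symmetry. apply psum_unique. auto.
Qed.

(** * Third-order jets at the origin *)

Definition near0 (P : C -> Prop) : Prop :=
  exists delta, 0 < delta /\ forall z, Cmod z < delta -> P z.

Lemma near0_and P Q : near0 P -> near0 Q -> near0 (fun z => P z /\ Q z).
Proof.
intros [d [Hd HP]] [e [He HQ]]. exists (Rmin d e); split; [now apply Rmin_pos|].
intros z Hz. split; [apply HP|apply HQ]; (eapply Rlt_le_trans; [exact Hz|]);
  [apply Rmin_l|apply Rmin_r].
Qed.

Lemma near0_imp (P Q : C -> Prop) : (forall z, P z -> Q z) -> near0 P -> near0 Q.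
Proof. intros H [d [Hd HP]]. exists d; split; auto. Qed.

Lemma near0_all (P : C -> Prop) : (forall z, P z) -> near0 P.
Proof. intros H. exists 1; split; [lra|auto]. Qed.

Lemma near0_lt r : 0 < r -> near0 (fun z => Cmod z < r).
Proof. intros H. exists r; auto. Qed.

Lemma near0_at (P : C -> Prop) : near0 P -> P 0.
Proof. intros [d [Hd H]]. apply H. now rewrite Cmod_0. Qed.

Definition bounded0 (h : C -> C) : Prop := exists M, near0 (fun z => Cmod (h z) <= M).

Lemma bounded0_const c : bounded0 (fun _ => c).
Proof. exists (Cmod c). apply near0_all. intros; lra. Qed.

Lemma bounded0_id : bounded0 (fun z => z).
Proof. exists 1. apply (near0_imp (fun z => Cmod z < 1)); [intros; lra|apply near0_lt; lra]. Qed.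

Lemma bounded0_plus f g : bounded0 f -> bounded0 g -> bounded0 (fun z => f z + g z)%C.
Proof.
intros [M H] [N K]. exists (M + N). apply (near0_imp _ _) with (2 := near0_and _ _ H K).
intros z [A B]. eapply Rle_trans; [apply Cmod_triangle|lra].
Qed.

Lemma bounded0_mult f g : bounded0 f -> bounded0 g -> bounded0 (fun z => f z * g z)%C.
Proof.
intros [M H] [N K]. exists (M * N). apply (near0_imp _ _) with (2 := near0_and _ _ H K).
intros z [A B]. rewrite Cmod_mult. apply Rmult_le_compat; auto; apply Cmod_ge_0.
Qed.

Lemma near0_comp P w W : bounded0 W -> near0 (fun z => w z = z * W z)%C ->
  near0 P -> near0 (fun z => P (w z)).
Proof.
intros [M HM] E [d [Hd HP]].
assert (Hk : 0 < d / (Rabs M + 1)).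
{ pose proof (Rabs_pos M). apply Rdiv_lt_0_compat; lra. }
apply (near0_imp _ _) with (2 := near0_and _ _ (near0_and _ _ HM E) (near0_lt _ Hk)).
intros z [[A B] Hz]. apply HP. rewrite B, Cmod_mult.
pose proof (Rabs_pos M). pose proof (Rle_abs M).
apply (Rmult_lt_compat_r (Rabs M + 1)) in Hz; [|lra].
replace (d / (Rabs M + 1) * (Rabs M + 1)) with d in Hz by (field; lra).
eapply Rle_lt_trans; [|exact Hz].
apply Rmult_le_compat; try apply Cmod_ge_0; lra.
Qed.

Lemma bounded0_comp R w W : bounded0 W -> near0 (fun z => w z = z * W z)%C ->
  bounded0 R -> bounded0 (fun z => R (w z)).
Proof.
intros HW E [M H]. exists M. exact (near0_comp _ w W HW E H).
Qed.

Lemma bounded0_inv h m : 0 < m -> near0 (fun z => m <= Cmod (h z)) -> bounded0 (fun z => / h z)%C.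
Proof.
intros Hm H. exists (/ m). apply (near0_imp _ _) with (2 := H).
intros z Hz. rewrite Cmod_inv by (apply Cmod_gt_0; lra). now apply Rinv_le_contravar.
Qed.

Ltac bounded := repeat (first [ assumption | apply bounded0_plus | apply bounded0_mult
  | apply bounded0_id | apply bounded0_const ]).

(** An expansion to order three; it includes the point 0, so that an inner function may vanish away
    from 0 in a composition. *)
Definition jet (F : C -> C) (c0 c1 c2 c3 : C) : Prop :=
  exists R, bounded0 R /\
    near0 (fun z => F z = c0 + z * (c1 + z * (c2 + z * (c3 + z * R z))))%C.

Lemma jet_eq F c0 c1 c2 c3 d0 d1 d2 d3 : jet F c0 c1 c2 c3 ->
  c0 = d0 -> c1 = d1 -> c2 = d2 -> c3 = d3 -> jet F d0 d1 d2 d3.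
Proof. now intros H -> -> -> ->. Qed.

Lemma jet_ext F G c0 c1 c2 c3 : near0 (fun z => F z = G z) -> jet F c0 c1 c2 c3 -> jet G c0 c1 c2 c3.
Proof.
intros E [R [HR H]]. exists R; split; [exact HR|].
apply (near0_imp _ _) with (2 := near0_and _ _ E H). intros z [A B]. now rewrite <- A.
Qed.

Lemma jet_const c : jet (fun _ => c) c 0 0 0.
Proof. exists (fun _ => RtoC 0). split; [bounded|]. apply near0_all; intros z; ring. Qed.

Lemma jet_id : jet (fun z => z) 0 1 0 0.
Proof. exists (fun _ => RtoC 0). split; [bounded|]. apply near0_all; intros z; ring. Qed.

Lemma jet_O4 R : bounded0 R -> jet (fun z => z ^ 4 * R z)%C 0 0 0 0.
Proof. intros H. exists R. split; [exact H|]. apply near0_all; intros z; ring. Qed.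

Lemma jet_plus F G c0 c1 c2 c3 d0 d1 d2 d3 :
  jet F c0 c1 c2 c3 -> jet G d0 d1 d2 d3 ->
  jet (fun z => F z + G z)%C (c0 + d0) (c1 + d1) (c2 + d2) (c3 + d3).
Proof.
intros [R [HR H]] [T [HT K]]. exists (fun z => R z + T z)%C. split; [bounded|].
apply (near0_imp _ _) with (2 := near0_and _ _ H K). intros z [A B]. rewrite A, B. ring.
Qed.

Lemma jet_mult F G c0 c1 c2 c3 d0 d1 d2 d3 :
  jet F c0 c1 c2 c3 -> jet G d0 d1 d2 d3 ->
  jet (fun z => F z * G z)%C (c0 * d0) (c0 * d1 + c1 * d0)
    (c0 * d2 + c1 * d1 + c2 * d0) (c0 * d3 + c1 * d2 + c2 * d1 + c3 * d0).
Proof.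
intros [R [HR H]] [T [HT K]].
exists (fun z => (c0 + z * (c1 + z * (c2 + z * (c3 + z * R z)))) * T z
   + R z * (d0 + z * (d1 + z * (d2 + z * d3)))
   + (c1 * d3 + c2 * (d2 + z * d3) + c3 * (d1 + z * (d2 + z * d3))))%C.
split; [bounded|].
apply (near0_imp _ _) with (2 := near0_and _ _ H K). intros z [A B]. rewrite A, B. ring.
Qed.

Lemma jet_scal a F c0 c1 c2 c3 : jet F c0 c1 c2 c3 ->
  jet (fun z => a * F z)%C (a * c0) (a * c1) (a * c2) (a * c3).
Proof. intros H. eapply jet_eq; [apply (jet_mult _ _ _ _ _ _ _ _ _ _ (jet_const a) H)|..]; ring. Qed.

(** At a point closer to 0 than [|e|] divided by the bound on [R], the two terms could
    not cancel. *)
Lemma leading_coefficient_unique e R : bounded0 R ->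
  near0 (fun z => z <> RtoC 0 -> e + z * R z = 0)%C -> e = RtoC 0.
Proof.
intros [M HM] H. apply NNPP; intros He.
apply Cmod_gt_0 in He.
assert (HK : 0 < Rabs M + 1) by (pose proof (Rabs_pos M); lra).
assert (Hq : 0 < Cmod e / (Rabs M + 1)) by now apply Rdiv_lt_0_compat.
destruct (near0_and _ _ (near0_and _ _ HM H) (near0_lt _ Hq)) as [d [Hd Hz]].
specialize (Hz (RtoC (d / 2))). rewrite Cmod_R, Rabs_pos_eq in Hz by lra.
destruct Hz as [[A B] L]; [lra|].
assert (Hne : RtoC (d / 2) <> RtoC 0) by (intros E; apply RtoC_inj in E; lra).
specialize (B Hne).
assert (E : e = (- (RtoC (d / 2) * R (RtoC (d / 2))))%C).
{ transitivity (e + RtoC (d/2) * R (RtoC (d/2)) - RtoC (d/2) * R (RtoC (d/2)))%C; [ring|].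
  rewrite B. ring. }
assert (E' : Cmod e = d / 2 * Cmod (R (RtoC (d / 2)))).
{ rewrite E at 1. rewrite Cmod_opp, Cmod_mult, Cmod_R, Rabs_pos_eq; lra. }
apply (Rmult_lt_compat_r (Rabs M + 1)) in L; [|exact HK].
replace (Cmod e / (Rabs M + 1) * (Rabs M + 1)) with (Cmod e) in L by (field; lra).
pose proof (Rle_abs M).
assert (d / 2 * Cmod (R (RtoC (d / 2))) <= d / 2 * (Rabs M + 1)).
{ apply Rmult_le_compat_l; lra. }
lra.
Qed.

Lemma jet_unique F c0 c1 c2 c3 d0 d1 d2 d3 :
  jet F c0 c1 c2 c3 -> jet F d0 d1 d2 d3 ->
  c0 = d0 /\ c1 = d1 /\ c2 = d2 /\ c3 = d3.
Proof.
intros [R [HR H]] [T [HT K]].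
assert (E : near0 (fun z => (c0 - d0) + z * ((c1 - d1) + z * ((c2 - d2) + z * ((c3 - d3) +
   z * (R z + (- (1)) * T z)))) = 0)%C).
{ apply (near0_imp _ _) with (2 := near0_and _ _ H K). intros z [A B].
  transitivity (F z - F z)%C; [|ring]. rewrite A at 1. rewrite B. ring. }
assert (D : forall e Q z, z <> RtoC 0 -> (e = RtoC 0 -> e + z * Q = 0 -> Q = RtoC 0)%C).
{ intros e Q z Hz -> HQ. rewrite Cplus_0_l in HQ.
  transitivity (/ z * (z * Q))%C; [field; exact Hz|]. rewrite HQ. ring. }
assert (E0 : (c0 - d0)%C = RtoC 0).
{ eapply leading_coefficient_unique; [|eapply near0_imp; [|exact E]; intros z A _; exact A].
  bounded. }
assert (E1' : near0 (fun z => z <> RtoC 0 -> (c1 - d1) + z * ((c2 - d2) + z * ((c3 - d3) +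
   z * (R z + (- (1)) * T z))) = 0)%C).
{ eapply near0_imp; [|exact E]. intros z A Hz. exact (D _ _ z Hz E0 A). }
assert (E1 : (c1 - d1)%C = RtoC 0).
{ eapply leading_coefficient_unique; [|exact E1']. bounded. }
assert (E2' : near0 (fun z => z <> RtoC 0 -> (c2 - d2) + z * ((c3 - d3) +
   z * (R z + (- (1)) * T z)) = 0)%C).
{ eapply near0_imp; [|exact E1']. intros z A Hz. exact (D _ _ z Hz E1 (A Hz)). }
assert (E2 : (c2 - d2)%C = RtoC 0).
{ eapply leading_coefficient_unique; [|exact E2']. bounded. }
assert (E3' : near0 (fun z => z <> RtoC 0 -> (c3 - d3) +
   z * (R z + (- (1)) * T z) = 0)%C).
{ eapply near0_imp; [|exact E2']. intros z A Hz. exact (D _ _ z Hz E2 (A Hz)). }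
assert (E3 : (c3 - d3)%C = RtoC 0).
{ eapply leading_coefficient_unique; [|exact E3']. bounded. }
assert (S : forall a b : C, (a - b)%C = RtoC 0 -> a = b).
{ intros a b Hab. transitivity (a - b + b)%C; [ring|]. rewrite Hab. ring. }
repeat split; now apply S.
Qed.

Lemma jet_at_0 F c0 c1 c2 c3 : jet F c0 c1 c2 c3 -> F 0 = c0.
Proof. intros [R [HR H]]. apply near0_at in H. rewrite H. ring. Qed.

(** A jet without constant term gives the factorization that makes compositions with
    this function on the inside harmless. *)
Lemma jet_factor w u1 u2 u3 : jet w 0 u1 u2 u3 ->
  exists W, bounded0 W /\ near0 (fun z => w z = z * W z)%C.
Proof.
intros [R [HR H]]. exists (fun z => u1 + z * (u2 + z * (u3 + z * R z)))%C.
split; [bounded|]. eapply near0_imp; [|exact H]. intros z A. rewrite A. ring.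
Qed.

Lemma jet_comp F w b0 b1 b2 b3 u1 u2 u3 :
  jet F b0 b1 b2 b3 -> jet w 0 u1 u2 u3 ->
  jet (fun z => F (w z)) b0 (b1 * u1) (b1 * u2 + b2 * u1 ^ 2)
    (b1 * u3 + 2 * b2 * u1 * u2 + b3 * u1 ^ 3).
Proof.
intros [R [HR H]] Hw. destruct (jet_factor _ _ _ _ Hw) as [W [HW E]].
apply (near0_comp _ w W HW E) in H.
apply (jet_ext (fun z => (b0 + (b1 * w z + (b2 * (w z * w z) + b3 * (w z * (w z * w z)))))
   + z ^ 4 * (W z * W z * (W z * W z) * R (w z)))%C).
- apply (near0_imp _ _) with (2 := near0_and _ _ H E). intros z [A B].
  rewrite A. generalize (R (w z)). intros r. rewrite B. ring.
- eapply jet_eq.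
  + apply jet_plus.
    * apply jet_plus; [apply jet_const|].
      apply jet_plus; [apply jet_scal, Hw|].
      apply jet_plus; apply jet_scal; repeat apply jet_mult; exact Hw.
    * apply jet_O4. pose proof (bounded0_comp R w W HW E HR). bounded.
  + ring.
  + ring.
  + ring.
  + ring.
Qed.

(** If [P] is the cubic polynomial inverse to the jet, then [1 - F * P] is [z^4] times a
    bounded function, and [1/F = P + (1 - F * P) / F] with [1/F] bounded. *)
Lemma jet_inv F c0 c1 c2 c3 : c0 <> RtoC 0 -> jet F c0 c1 c2 c3 ->
  exists d0 d1 d2 d3, jet (fun z => / F z)%C d0 d1 d2 d3 /\ near0 (fun z => F z <> RtoC 0).
Proof.
intros H0 HF.
assert (Hlow : near0 (fun z => Cmod c0 / 2 <= Cmod (F z))).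
{ destruct HF as [R [HR H]].
  assert (HB : bounded0 (fun z => c1 + z * (c2 + z * (c3 + z * R z)))%C) by bounded.
  destruct HB as [M HM].
  assert (Hc : 0 < Cmod c0) by now apply Cmod_gt_0.
  assert (HK : 0 < Rabs M + 1) by (pose proof (Rabs_pos M); lra).
  assert (Hq : 0 < Cmod c0 / 2 / (Rabs M + 1)) by (apply Rdiv_lt_0_compat; lra).
  apply (near0_imp _ _) with (2 := near0_and _ _ (near0_and _ _ H HM) (near0_lt _ Hq)).
  intros z [[A B] L]. left. apply Cminus_lower; [exact H0|]. rewrite A.
  set (X := (c1 + z * (c2 + z * (c3 + z * R z)))%C) in *.
  replace (c0 + z * X - c0)%C with (z * X)%C by ring. rewrite Cmod_mult.
  apply (Rmult_lt_compat_r (Rabs M + 1)) in L; [|exact HK].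
  replace (Cmod c0 / 2 / (Rabs M + 1) * (Rabs M + 1)) with (Cmod c0 / 2) in L by (field; lra).
  eapply Rle_lt_trans; [|exact L]. pose proof (Rle_abs M).
  apply Rmult_le_compat; try apply Cmod_ge_0; lra. }
assert (Hc : 0 < Cmod c0 / 2) by (apply Cmod_gt_0 in H0; lra).
assert (Hne : near0 (fun z => F z <> RtoC 0)).
{ eapply near0_imp; [|exact Hlow]. intros z A. apply Cmod_gt_0. lra. }
set (d0 := (/ c0)%C). set (d1 := (- c1 / c0 ^ 2)%C).
set (d2 := ((c1 ^ 2 - c0 * c2) / c0 ^ 3)%C).
set (d3 := ((- c1 ^ 3 + 2 * c0 * c1 * c2 - c0 ^ 2 * c3) / c0 ^ 4)%C).
exists d0, d1, d2, d3. split; [|exact Hne].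
pose proof (bounded0_inv F _ Hc Hlow) as HI.
set (P := fun z => (d0 + z * (d1 + z * (d2 + z * (d3 + z * 0))))%C).
assert (HP : jet P d0 d1 d2 d3).
{ exists (fun _ => RtoC 0). split; [bounded|]. apply near0_all. reflexivity. }
assert (H1 : jet (fun z => 1 + (- (1)) * (F z * P z))%C 0 0 0 0).
{ eapply jet_eq; [apply jet_plus; [apply jet_const|apply jet_scal; exact (jet_mult _ _ _ _ _ _ _ _ _ _ HF HP)]|..];
    unfold d0, d1, d2, d3; field; exact H0. }
destruct H1 as [R [HR E]].
exists (fun z => / F z * R z)%C. split; [bounded|].
apply (near0_imp _ _) with (2 := near0_and _ _ E Hne). intros z [A B].
transitivity (P z + / F z * (1 + - (1) * (F z * P z)))%C.
- field. exact B.
- rewrite A. unfold P. ring.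
Qed.

(** The cubic polynomial that inverts [phi] at 0 up to order four recovers [w] from
    [phi o w], up to [w^4] times a bounded function, which is [z^4] times a bounded
    function because [w] is already known to be of order [z]. *)
Lemma jet_root phi w W b0 b1 b2 b3 d0 d1 d2 d3 :
  jet phi b0 b1 b2 b3 -> b1 <> RtoC 0 ->
  bounded0 W -> near0 (fun z => w z = z * W z)%C ->
  jet (fun z => phi (w z)) d0 d1 d2 d3 ->
  exists u1 u2 u3, jet w 0 u1 u2 u3.
Proof.
intros Hphi Hb HW E Hc.
(* the cubic polynomial in [f - b0] inverting the jet [b0 + b1 y + b2 y^2 + b3 y^3] *)
set (L := fun f : C -> C => fun z => (/ b1 * (f z + - b0) + (- b2 / b1 ^ 3 * ((f z + - b0) * (f z + - b0))
   + (2 * b2 ^ 2 - b1 * b3) / b1 ^ 5 * ((f z + - b0) * ((f z + - b0) * (f z + - b0)))))%C).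
assert (HL : forall f c0 c1 c2 c3, jet f c0 c1 c2 c3 ->
  jet (L f) (/ b1 * (c0 + - b0) + (- b2 / b1 ^ 3 * ((c0 + - b0) * (c0 + - b0))
   + (2 * b2 ^ 2 - b1 * b3) / b1 ^ 5 * ((c0 + - b0) * ((c0 + - b0) * (c0 + - b0)))))
   (/ b1 * c1 + (- b2 / b1 ^ 3 * (2 * (c0 + - b0) * c1)
   + (2 * b2 ^ 2 - b1 * b3) / b1 ^ 5 * (3 * (c0 + - b0) ^ 2 * c1)))
   (/ b1 * c2 + (- b2 / b1 ^ 3 * (2 * (c0 + - b0) * c2 + c1 ^ 2)
   + (2 * b2 ^ 2 - b1 * b3) / b1 ^ 5 * (3 * (c0 + - b0) ^ 2 * c2 + 3 * (c0 + - b0) * c1 ^ 2)))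
   (/ b1 * c3 + (- b2 / b1 ^ 3 * (2 * (c0 + - b0) * c3 + 2 * c1 * c2)
   + (2 * b2 ^ 2 - b1 * b3) / b1 ^ 5 * (3 * (c0 + - b0) ^ 2 * c3 + 6 * (c0 + - b0) * c1 * c2 + c1 ^ 3)))).
{ intros f c0 c1 c2 c3 Hf.
  pose proof (jet_plus _ _ _ _ _ _ _ _ _ _ Hf (jet_const (- b0))) as Hs.
  eapply jet_eq.
  - apply jet_plus; [apply jet_scal, Hs|].
    apply jet_plus; apply jet_scal; repeat apply jet_mult; exact Hs.
  - ring.
  - ring.
  - ring.
  - ring. }
assert (H1 : jet (fun y => L phi y + (- (1)) * y)%C 0 0 0 0).
{ eapply jet_eq; [apply jet_plus; [apply HL, Hphi|apply jet_scal, jet_id]|..]; field; exact Hb. }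
destruct H1 as [R [HR H]].
apply (near0_comp _ w W HW E) in H.
pose proof (bounded0_comp R w W HW E HR) as HRw.
assert (J : exists e0 e1 e2 e3, jet w e0 e1 e2 e3).
{ do 4 eexists.
  apply (jet_ext (fun z => L (fun z => phi (w z)) z + (- (1)) * (z ^ 4 * (W z * W z * (W z * W z) * R (w z))))%C).
  - apply (near0_imp _ _) with (2 := near0_and _ _ H E). intros z [A B].
    change (L (fun z => phi (w z)) z) with (L phi (w z)).
    transitivity (w z + (L phi (w z) + - (1) * w z) - w z ^ 4 * R (w z))%C.
    + generalize (R (w z)). intros r. generalize (L phi (w z)). intros l. rewrite B. ring.
    + rewrite A. ring.
  - apply jet_plus; [apply HL, Hc|]. apply jet_scal, jet_O4. bounded. }
destruct J as [e0 [e1 [e2 [e3 J]]]].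
assert (e0 = RtoC 0).
{ rewrite <- (jet_at_0 _ _ _ _ _ J). apply near0_at in E. rewrite E. ring. }
subst e0. now exists e1, e2, e3.
Qed.

Lemma jet_psum a M rho : 0 < rho -> geom_bounded a M rho ->
  jet (psum a) (a 0%nat) (a 1%nat) (a 2%nat) (a 3%nat).
Proof.
intros Hr Ha.
assert (HB : forall z, Cmod z < / (2 * rho) -> Cmod z * rho <= / 2).
{ intros z Hz. apply (Rmult_lt_compat_r rho) in Hz; [|exact Hr].
  replace (/ (2 * rho) * rho) with (/ 2) in Hz by (field; lra). lra. }
assert (Hd : 0 < / (2 * rho)) by (apply Rinv_0_lt_compat; lra).
pose proof (geom_bounded_shift _ _ _ Ha) as H1.
pose proof (geom_bounded_shift _ _ _ H1) as H2.
pose proof (geom_bounded_shift _ _ _ H2) as H3.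
pose proof (geom_bounded_shift _ _ _ H3) as H4.
exists (psum (shift (shift (shift (shift a))))). split.
- exists (2 * (M * rho * rho * rho * rho)), (/ (2 * rho)). split; [exact Hd|]. intros z Hz.
  apply (psum_bound _ _ rho); [exact Hr|exact H4|now apply HB].
- exists (/ (2 * rho)). split; [exact Hd|]. intros z Hz. specialize (HB z Hz).
  rewrite (psum_shift a M rho) by auto.
  rewrite (psum_shift (shift a) (M * rho) rho) by auto.
  rewrite (psum_shift (shift (shift a)) (M * rho * rho) rho) by auto.
  rewrite (psum_shift (shift (shift (shift a))) (M * rho * rho * rho) rho) by auto.
  reflexivity.
Qed.

(** Differentiability alone bounds [w z / z] near 0. *)
Lemma has_cderiv_factor w l : has_cderiv w 0 l -> w 0 = RtoC 0 ->
  exists W, bounded0 W /\ near0 (fun z => w z = z * W z)%C.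
Proof.
intros H H0. exists (fun z => w z / z)%C. split.
- exists (Cmod l + 1). destruct (H 1 Rlt_0_1) as [d [Hd H1]].
  exists d; split; [exact Hd|]. intros z Hz.
  destruct (Ceq_dec z 0) as [->|Hne].
  + rewrite H0. unfold Cdiv. rewrite Cmult_0_l, Cmod_0. pose proof (Cmod_ge_0 l). lra.
  + specialize (H1 z). rewrite Cminus_0_r, H0, Cminus_0_r in H1. specialize (H1 Hz).
    assert (Hm : 0 < Cmod z) by now apply Cmod_gt_0.
    rewrite Cmod_div by exact Hne.
    apply Rmult_le_reg_r with (Cmod z); [exact Hm|].
    unfold Rdiv. rewrite Rmult_assoc, Rinv_l, Rmult_1_r by lra.
    replace (w z) with ((w z - l * z) + l * z)%C by ring.
    eapply Rle_trans; [apply Cmod_triangle|]. rewrite Cmod_mult. lra.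
- apply near0_all. intros z. destruct (Ceq_dec z 0) as [->|Hne].
  + rewrite H0. ring.
  + field. exact Hne.
Qed.

(** * Coefficients of Schwarz functions *)

(** [caratheodory_coefficient] for the function [(p - T) / z^(n+1)], [T] the Taylor
    polynomial, extended by [e] at 0. *)
Lemma caratheodory_jet (p X : C -> C) (c : nat -> C) (n : nat) (e : C) :
  (forall z, in_disk z -> exists l, has_cderiv p z l) ->
  (forall z, in_disk z -> 0 <= Re (p z)) ->
  p 0 = RtoC 1 -> bounded0 X ->
  near0 (fun z => p z = Csum (fun m => c m * z ^ m) n + z ^ (n + 1) * (e + z * X z))%C ->
  Cmod e <= 2.
Proof.
intros Hp Hre Hp0 HX E.
set (T := fun z => Csum (fun m => c m * z ^ m)%C n).
set (S := fun z => if Ceq_dec z 0 then e else ((p z - T z) / z ^ (n + 1))%C).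
assert (HS0 : S 0 = e) by (unfold S; destruct (Ceq_dec 0 0); tauto).
rewrite <- HS0.
apply (caratheodory_coefficient p S c n Hp Hre Hp0).
- intros z _. fold (T z). unfold S. destruct (Ceq_dec z 0) as [->|Hz].
  + apply near0_at in E. fold (T 0) in E. rewrite E.
    rewrite Nat.add_1_r, Cpow_0_S. ring.
  + field. now apply Cpow_nz.
- intros eps He. destruct HX as [M HM].
  assert (Hq : 0 < eps / (Rabs M + 1)).
  { pose proof (Rabs_pos M). apply Rdiv_lt_0_compat; lra. }
  destruct (near0_and _ _ (near0_and _ _ E HM) (near0_lt _ Hq)) as [d [Hd H]].
  exists d; split; [exact Hd|]. intros z Hz. rewrite HS0.
  destruct (H z Hz) as [[A B] L].
  unfold S. destruct (Ceq_dec z 0) as [->|Hne].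
  + replace (e - e)%C with (RtoC 0) by ring. now rewrite Cmod_0.
  + fold (T z) in A. rewrite A.
    replace ((T z + z ^ (n + 1) * (e + z * X z) - T z) / z ^ (n + 1) - e)%C with (z * X z)%C
      by (field; now apply Cpow_nz).
    rewrite Cmod_mult. pose proof (Rabs_pos M). pose proof (Rle_abs M).
    apply (Rmult_lt_compat_r (Rabs M + 1)) in L; [|lra].
    replace (eps / (Rabs M + 1) * (Rabs M + 1)) with eps in L by (field; lra).
    eapply Rle_lt_trans; [|exact L].
    apply Rmult_le_compat; try apply Cmod_ge_0; lra.
Qed.

Lemma analytic_has_cderiv f z : analytic f -> in_disk z -> exists l, has_cderiv f z l.
Proof. intros H Hz. destruct (H z Hz) as [l Hl]. exists l. now apply has_cderiv_is_derive. Qed.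

Lemma Re_cayley_nonneg (w : C) : Cmod w < 1 -> w <> RtoC 1 -> 0 <= Re ((1 + w) * / (1 + - (1) * w))%C.
Proof.
intros Hw H1.
assert (Hsq : Re w ^ 2 + Im w ^ 2 < 1).
{ rewrite <- Cmod2_alt. pose proof (Cmod_ge_0 w). simpl. nra. }
destruct w as [x y]. simpl in Hsq.
unfold Re, Cmult, Cinv, Cplus, Copp, RtoC; simpl.
unfold Re, Im in Hsq; simpl in Hsq.
assert (Hx : x < 1).
{ apply Rnot_le_lt; intros Hx. nra. }
assert (Hd : 0 < (1 + (-1 * x - -0 * y)) * ((1 + (-1 * x - -0 * y)) * 1) +
  (0 + (-1 * y + -0 * x)) * ((0 + (-1 * y + -0 * x)) * 1)) by nra.
match goal with |- 0 <= ?g =>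
  replace g with ((1 - x * x - y * y) / ((1 + (-1 * x - -0 * y)) * ((1 + (-1 * x - -0 * y)) * 1) +
  (0 + (-1 * y + -0 * x)) * ((0 + (-1 * y + -0 * x)) * 1))) end.
- apply Rmult_le_pos; [nra|]. left. now apply Rinv_0_lt_compat.
- field. apply Rgt_not_eq. nra.
Qed.

(** [cayley1], [cayley2] and [cayley3] are the coefficients of [(1 + w) / (1 - w)] for
    [w = u1 z + u2 z^2 + u3 z^3 + ...]. *)
Definition cayley1 (u1 : C) : C := (2 * u1)%C.
Definition cayley2 (u1 u2 : C) : C := (2 * u2 + 2 * u1 ^ 2)%C.
Definition cayley3 (u1 u2 u3 : C) : C := (2 * u3 + 4 * u1 * u2 + 2 * u1 ^ 3)%C.

(** The function [p = (1 + w) / (1 - w)] has nonnegative real part; its coefficients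
    follow from [p * (1 - w) = 1 + w]. *)
Lemma cayley_bounds w u1 u2 u3 : analytic w -> (forall z, in_disk z -> Cmod (w z) < 1) ->
  jet w 0 u1 u2 u3 ->
  Cmod (cayley1 u1) <= 2 /\ Cmod (cayley2 u1 u2) <= 2 /\ Cmod (cayley3 u1 u2 u3) <= 2.
Proof.
intros Ha Hw J.
set (q := fun z => (1 + - (1) * w z)%C).
set (p := fun z => ((1 + w z) * / q z)%C).
assert (Hne : forall z, in_disk z -> w z <> RtoC 1).
{ intros z Hz E. specialize (Hw z Hz). rewrite E, Cmod_1 in Hw. lra. }
assert (Hq : forall z, in_disk z -> q z <> RtoC 0).
{ intros z Hz E. apply (Hne z Hz). transitivity (1 - q z)%C; [unfold q; ring|]. rewrite E. ring. }
assert (Hp : forall z, in_disk z -> exists l, has_cderiv p z l).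
{ intros z Hz. destruct (analytic_has_cderiv w z Ha Hz) as [l Hl].
  eexists. apply has_cderiv_mult.
  - apply has_cderiv_plus; [apply has_cderiv_const|exact Hl].
  - apply has_cderiv_inv; [now apply Hq|].
    apply has_cderiv_plus; [apply has_cderiv_const|]. apply has_cderiv_scal, Hl. }
assert (Hre : forall z, in_disk z -> 0 <= Re (p z)).
{ intros z Hz. apply Re_cayley_nonneg; auto. }
assert (Hp0 : p 0 = RtoC 1).
{ unfold p, q. rewrite (jet_at_0 _ _ _ _ _ J). field. }
pose proof (jet_plus _ _ _ _ _ _ _ _ _ _ (jet_const 1) J) as Jn.
pose proof (jet_plus _ _ _ _ _ _ _ _ _ _ (jet_const 1) (jet_scal (- (1)) _ _ _ _ _ J)) as Jq.
fold q in Jq.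
assert (Hq0 : (1 + - (1) * 0)%C <> RtoC 0).
{ intros E. apply C1_nz. rewrite <- E. ring. }
destruct (jet_inv q _ _ _ _ Hq0 Jq) as [i0 [i1 [i2 [i3 [Ji Nq]]]]].
pose proof (jet_mult _ _ _ _ _ _ _ _ _ _ Jn Ji) as Jp. fold p in Jp.
revert Jp. generalize ((1 + 0) * i0)%C ((1 + 0) * i1 + (0 + u1) * i0)%C
  ((1 + 0) * i2 + (0 + u1) * i1 + (0 + u2) * i0)%C
  ((1 + 0) * i3 + (0 + u1) * i2 + (0 + u2) * i1 + (0 + u3) * i0)%C.
intros e0 e1 e2 e3 Jp.
assert (Jpq := jet_mult _ _ _ _ _ _ _ _ _ _ Jp Jq).
apply (jet_ext _ (fun z => 1 + w z)%C) in Jpq.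
2: { eapply near0_imp; [|exact Nq]. intros z Hz. change (p z * q z = 1 + w z)%C. unfold p. field. exact Hz. }
destruct (jet_unique _ _ _ _ _ _ _ _ _ Jpq Jn) as [E0 [E1 [E2 E3]]].
assert (H0 : e0 = RtoC 1) by (rewrite <- Hp0; symmetry; exact (jet_at_0 _ _ _ _ _ Jp)).
subst e0.
assert (H1 : e1 = cayley1 u1).
{ unfold cayley1. transitivity ((1 * (0 + - (1) * u1) + e1 * (1 + - (1) * 0)) + u1)%C; [ring|].
  rewrite E1. ring. }
subst e1.
assert (H2 : e2 = cayley2 u1 u2).
{ transitivity ((1 * (0 + - (1) * u2) + cayley1 u1 * (0 + - (1) * u1) + e2 * (1 + - (1) * 0)) + u2
    + cayley1 u1 * u1)%C; [ring|]. rewrite E2. unfold cayley1, cayley2. ring. }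
subst e2.
assert (H3 : e3 = cayley3 u1 u2 u3).
{ transitivity ((1 * (0 + - (1) * u3) + cayley1 u1 * (0 + - (1) * u2)
   + cayley2 u1 u2 * (0 + - (1) * u1) + e3 * (1 + - (1) * 0)) + u3
    + cayley1 u1 * u2 + cayley2 u1 u2 * u1)%C; [ring|].
  rewrite E3. unfold cayley1, cayley2, cayley3. ring. }
subst e3. clear E0 E1 E2 E3 Jpq.
destruct Jp as [R [HR E]].
set (c := fun n => match n with 0%nat => RtoC 1 | 1%nat => cayley1 u1 | _ => cayley2 u1 u2 end).
repeat split.
- apply (caratheodory_jet p (fun z => cayley2 u1 u2 + z * (cayley3 u1 u2 u3 + z * R z))%C c 0); auto; [bounded|].
  eapply near0_imp; [|exact E]. intros z A. etransitivity; [exact A|]. rewrite Csum_O. simpl. ring.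
- apply (caratheodory_jet p (fun z => cayley3 u1 u2 u3 + z * R z)%C c 1); auto; [bounded|].
  eapply near0_imp; [|exact E]. intros z A. etransitivity; [exact A|]. rewrite Csum_S, Csum_O. simpl. ring.
- apply (caratheodory_jet p R c 2); auto.
  eapply near0_imp; [|exact E]. intros z A. etransitivity; [exact A|]. rewrite !Csum_S, Csum_O. simpl. ring.
Qed.

(** * Jets of the starlikeness quotient of a function and of its inverse *)

Lemma C_derive_unique f z l : has_cderiv f z l -> C_derive f z = l.
Proof. intros H. apply is_C_derive_unique. now apply has_cderiv_is_derive. Qed.

Lemma near0_near P : near0 P -> near0 (fun z => exists r, 0 < r /\ forall y, Cmod (y - z) < r -> P y).
Proof.
intros [d [Hd H]]. exists d; split; [exact Hd|]. intros z Hz.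
exists (d - Cmod z). split; [lra|]. intros y Hy. apply H.
pose proof (Cmod_triangle z (y - z)) as T. replace (z + (y - z))%C with y in T by ring. lra.
Qed.

Lemma near0_has_cderiv_C_derive f f1 f2 :
  near0 (fun z => has_cderiv f z (f1 z)) -> near0 (fun z => has_cderiv f1 z (f2 z)) ->
  near0 (fun z => C_derive f z = f1 z /\ C_derive (C_derive f) z = f2 z).
Proof.
intros H1 H2.
assert (E : near0 (fun z => C_derive f z = f1 z)).
{ eapply near0_imp; [|exact H1]. intros z. apply C_derive_unique. }
apply near0_and; [exact E|].
apply (near0_imp _ _) with (2 := near0_and _ _ (near0_near _ E) H2).
intros z [[r [Hr A]] B]. apply C_derive_unique.
apply (has_cderiv_ext_loc f1 _ z _ r Hr); [|exact B].
intros y Hy. symmetry. now apply A.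
Qed.

(** For solving a linear equation [x = y] for an unknown that occurs in it with
    coefficient one. *)
Lemma Ceq_of (x y u v : C) : x = y -> (u - v = x - y)%C -> u = v.
Proof.
intros -> H. transitivity (u - v + v)%C; [ring|]. rewrite H. ring.
Qed.

(** Near 0, [f = z * fh], [f' = f1] and [f'' = f2].  The last coefficient of the jet of
    [f2] is left unnamed: it involves the fifth coefficient of [f], whereas [f2] enters
    the starlikeness quotient multiplied by [z]. *)
Record normalized_germ (f : C -> C) (a2 a3 a4 : C) (fh f1 f2 : C -> C) : Prop := {
  germ_value : near0 (fun z => f z = z * fh z)%C;
  germ_deriv : near0 (fun z => has_cderiv f z (f1 z));
  germ_deriv2 : near0 (fun z => has_cderiv f1 z (f2 z));
  germ_jet : jet fh 1 a2 a3 a4;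
  germ_jet1 : jet f1 1 (2 * a2) (3 * a3) (4 * a4);
  germ_jet2 : exists b, jet f2 (2 * a2) (6 * a3) (12 * a4) b }.

Lemma taylor_germ a f : taylor a f -> a 0%nat = RtoC 0 -> a 1%nat = RtoC 1 ->
  exists fh f1 f2, normalized_germ f (a 2%nat) (a 3%nat) (a 4%nat) fh f1 f2.
Proof.
intros Ht H0 H1. destruct (taylor_psum a f Ht) as [[M HM] E].
pose proof (geom_bounded_dcoef a M 2 ltac:(lra) HM) as HM1.
pose proof (geom_bounded_dcoef _ _ (2 * 2) ltac:(lra) HM1) as HM2.
exists (psum (shift a)), (psum (dcoef a)), (psum (dcoef (dcoef a))).
assert (D : forall b N rho, 0 < rho -> geom_bounded b N rho ->
  near0 (fun z => has_cderiv (psum b) z (psum (dcoef b) z))).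
{ intros b N rho Hr Hb. exists (/ (4 * rho)). split; [apply Rinv_0_lt_compat; lra|].
  intros z Hz. apply (psum_derivative b N rho); auto.
  apply (Rmult_lt_compat_r (4 * rho)) in Hz; [|lra]. rewrite Rinv_l in Hz; lra. }
assert (E1 : near0 (fun z => f z = psum a z)).
{ apply (near0_imp (fun z => Cmod z < 1)); [exact E|apply near0_lt; lra]. }
constructor.
- apply (near0_imp (fun z => Cmod z < / 4)); [|apply near0_lt; lra].
  intros z Hz. rewrite E by (unfold in_disk; lra).
  rewrite (psum_shift a M 2) by (auto; lra). rewrite H0. ring.
- apply (near0_imp _ _) with (2 := near0_and _ _ (near0_near _ E1) (D a M 2 ltac:(lra) HM)).
  intros z [[r [Hr A]] B]. apply (has_cderiv_ext_loc (psum a) _ z _ r Hr); [|exact B].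
  intros y Hy. symmetry. now apply A.
- apply (D _ (M * 2) (2 * 2)); [lra|exact HM1].
- pose proof (jet_psum _ _ 2 ltac:(lra) (geom_bounded_shift _ _ _ HM)) as J.
  unfold shift in J at 2. rewrite H1 in J. exact J.
- eapply jet_eq; [apply (jet_psum _ (M * 2) (2 * 2)); [lra|exact HM1]|..];
    unfold dcoef; rewrite !S_INR; simpl; rewrite ?H1.
  + replace (0 + 1) with 1 by ring. ring.
  + replace (0 + 1 + 1) with 2 by ring. ring.
  + replace (0 + 1 + 1 + 1) with 3 by ring. ring.
  + replace (0 + 1 + 1 + 1 + 1) with 4 by ring. ring.
- exists (20 * a 5%nat)%C.
  eapply jet_eq; [eapply jet_psum; [|exact HM2]; lra|..];
    unfold dcoef; rewrite !S_INR; simpl.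
  + replace (0 + 1 + 1) with 2 by ring. replace (0 + 1) with 1 by ring. ring.
  + replace (0 + 1 + 1 + 1) with 3 by ring. replace (0 + 1 + 1) with 2 by ring. ring.
  + replace (0 + 1 + 1 + 1 + 1) with 4 by ring. replace (0 + 1 + 1 + 1) with 3 by ring. ring.
  + replace (0 + 1 + 1 + 1 + 1 + 1) with 5 by ring. replace (0 + 1 + 1 + 1 + 1) with 4 by ring. ring.
Qed.

Lemma jet_div F G H g0 g1 g2 g3 h0 h1 h2 h3 :
  jet G g0 g1 g2 g3 -> g0 <> RtoC 0 -> jet H h0 h1 h2 h3 ->
  near0 (fun z => F z * G z = H z)%C ->
  exists d0 d1 d2 d3, jet F d0 d1 d2 d3 /\
    (d0 * g0 = h0)%C /\ (d0 * g1 + d1 * g0 = h1)%C /\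
    (d0 * g2 + d1 * g1 + d2 * g0 = h2)%C /\
    (d0 * g3 + d1 * g2 + d2 * g1 + d3 * g0 = h3)%C.
Proof.
intros JG G0 JH E.
destruct (jet_inv G _ _ _ _ G0 JG) as [i0 [i1 [i2 [i3 [Ji N]]]]].
assert (JF : exists d0 d1 d2 d3, jet F d0 d1 d2 d3).
{ do 4 eexists. apply (jet_ext (fun z => H z * / G z)%C); [|exact (jet_mult _ _ _ _ _ _ _ _ _ _ JH Ji)].
  apply (near0_imp _ _) with (2 := near0_and _ _ E N). intros z [A B].
  rewrite <- A. field. exact B. }
destruct JF as [d0 [d1 [d2 [d3 JF]]]]. exists d0, d1, d2, d3. split; [exact JF|].
pose proof (jet_mult _ _ _ _ _ _ _ _ _ _ JF JG) as JFG.
apply (jet_unique H); [|exact JH].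
exact (jet_ext _ _ _ _ _ _ E JFG).
Qed.

(** [w] is of order [z] because it is differentiable and vanishes at 0, so [jet_root]
    gives it a jet, and its coefficients are those of a Schwarz function. *)
Lemma subordinate_coefficients B B1 phi F d0 d1 d2 d3 :
  taylor B phi -> B 1%nat = RtoC B1 -> 0 < B1 -> subordinate F phi -> jet F d0 d1 d2 d3 ->
  exists u1 u2 u3,
    (Cmod (cayley1 u1) <= 2 /\ Cmod (cayley2 u1 u2) <= 2 /\ Cmod (cayley3 u1 u2 u3) <= 2) /\
    (d1 = B1 * u1 /\ d2 = B1 * u2 + B 2%nat * u1 ^ 2 /\
     d3 = B1 * u3 + 2 * B 2%nat * u1 * u2 + B 3%nat * u1 ^ 3)%C.
Proof.
intros HB EB1 HB1 [_ [_ [w [Hw [w0 [Hlt HF]]]]]] JF.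
destruct (taylor_psum B phi HB) as [[M HM] Ephi].
pose proof (jet_psum B M 2 ltac:(lra) HM) as Jphi.
apply (jet_ext _ phi) in Jphi.
2: { apply (near0_imp (fun z => Cmod z < 1)); [|apply near0_lt; lra].
  intros z Hz. symmetry. now apply Ephi. }
rewrite EB1 in Jphi.
destruct (analytic_has_cderiv w 0 Hw) as [l Hl]; [unfold in_disk; rewrite Cmod_0; lra|].
destruct (has_cderiv_factor w l Hl w0) as [W [HW EW]].
assert (JFw : jet (fun z => phi (w z)) d0 d1 d2 d3).
{ apply (jet_ext F); [|exact JF].
  apply (near0_imp (fun z => Cmod z < 1)); [exact HF|apply near0_lt; lra]. }
destruct (jet_root phi w W _ _ _ _ d0 d1 d2 d3 Jphi) as [u1 [u2 [u3 Jw]]]; auto.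
{ intros E. apply RtoC_inj in E. lra. }
exists u1, u2, u3. split; [now apply (cayley_bounds w)|].
destruct (jet_unique _ _ _ _ _ _ _ _ _ JFw (jet_comp _ _ _ _ _ _ _ _ _ Jphi Jw)) as [_ H].
exact H.
Qed.

Lemma subordinate_at_0 B phi F : taylor B phi -> B 0%nat = RtoC 1 -> subordinate F phi -> F 0 = RtoC 1.
Proof.
intros HB B0 [_ [_ [w [_ [w0 [_ HF]]]]]].
destruct (taylor_psum B phi HB) as [[M HM] E].
assert (D0 : in_disk 0) by (unfold in_disk; rewrite Cmod_0; lra).
rewrite (HF 0 D0), w0, (E 0 D0), (psum_shift B M 2), B0; auto.
- ring.
- lra.
- rewrite Cmod_0; lra.
Qed.

(** [st1], [st2] and [st3] are the Taylor coefficients of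
    [z f'/f + lam z^2 f''/f] for [f = z + a2 z^2 + a3 z^3 + a4 z^4 + ...]. *)
Definition st1 (lam : R) (a2 : C) : C := ((1 + 2 * lam) * a2)%C.
Definition st2 (lam : R) (a2 a3 : C) : C :=
  (2 * (1 + 3 * lam) * a3 - (1 + 2 * lam) * a2 ^ 2)%C.
Definition st3 (lam : R) (a2 a3 a4 : C) : C :=
  (3 * (1 + 4 * lam) * a4 - (3 + 8 * lam) * a2 * a3 + (1 + 2 * lam) * a2 ^ 3)%C.

(** Dividing numerator and denominator by [z], the quotient satisfies
    [F * fh = f1 + lam * z * f2], from which its jet is solved for. *)
Lemma ST_jet lam phi B f a2 a3 a4 fh f1 f2 :
  taylor B phi -> B 0%nat = RtoC 1 -> ST lam phi f -> normalized_germ f a2 a3 a4 fh f1 f2 ->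
  exists F, subordinate F phi /\ jet F 1 (st1 lam a2) (st2 lam a2 a3) (st3 lam a2 a3 a4).
Proof.
intros HB B0 [_ [F [HF HS]]] G. exists F. split; [exact HS|].
pose proof (subordinate_at_0 B phi F HB B0 HS) as F0.
destruct G as [Ev Ed Ed2 Jh J1 [b J2]].
pose proof (near0_has_cderiv_C_derive _ _ _ Ed Ed2) as ED.
assert (E : near0 (fun z => F z * fh z = f1 z + lam * (z * f2 z))%C).
{ apply (near0_imp _ _) with (2 := near0_and _ _ (near0_and _ _ Ev ED) (near0_lt 1 Rlt_0_1)).
  intros z [[A [C1 C2]] Hz].
  destruct (Ceq_dec z 0) as [->|Hne].
  - rewrite F0, (jet_at_0 _ _ _ _ _ Jh), (jet_at_0 _ _ _ _ _ J1). ring.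
  - destruct (HF z Hz Hne) as [Hfz HFz]. rewrite HFz, C1, C2, A. field.
    split; [|exact Hne]. intros E. apply Hfz. rewrite A, E. ring. }
destruct (jet_div F _ _ _ _ _ _ _ _ _ _ Jh C1_nz
  (jet_plus _ _ _ _ _ _ _ _ _ _ J1 (jet_scal lam _ _ _ _ _ (jet_mult _ _ _ _ _ _ _ _ _ _ jet_id J2))) E)
  as [d0 [d1 [d2 [d3 [JF [E0 [E1 [E2 E3]]]]]]]].
assert (d0 = RtoC 1) by (apply (Ceq_of _ _ _ _ E0); ring). subst d0.
assert (d1 = st1 lam a2) by (apply (Ceq_of _ _ _ _ E1); unfold st1; ring). subst d1.
assert (d2 = st2 lam a2 a3) by (apply (Ceq_of _ _ _ _ E2); unfold st1, st2; ring). subst d2.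
assert (d3 = st3 lam a2 a3 a4) by (apply (Ceq_of _ _ _ _ E3); unfold st1, st2, st3; ring). subst d3.
exact JF.
Qed.

(** [f (g x) = x] gives the jet of [g] by [jet_root] and its derivatives near 0:
    [g' = 1 / f1(g)] and [g'' = - f2(g) / f1(g)^3].  So the quotient of [g] is
    [fh / f1 - lam * y * fh^2 * f2 / f1^3] at [y = g x], a composition of known jets.
    The coefficients are those of [ST_jet] at the coefficients of the inverse
    [x - a2 x^2 + (2 a2^2 - a3) x^3 - (5 a2^3 - 5 a2 a3 + a4) x^4 + ...]. *)
Lemma ST_inverse_jet lam phi B f g a2 a3 a4 fh f1 f2 :
  taylor B phi -> B 0%nat = RtoC 1 -> normalized f -> univalent f ->
  inverse_continuation f g -> ST lam phi g -> normalized_germ f a2 a3 a4 fh f1 f2 ->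
  exists G, subordinate G phi /\
    jet G 1 (st1 lam (- a2)) (st2 lam (- a2) (2 * a2 ^ 2 - a3))
      (st3 lam (- a2) (2 * a2 ^ 2 - a3) (- (5 * a2 ^ 3 - 5 * a2 * a3 + a4))).
Proof.
intros HB B0 Hnf [_ Hinj] [[Hga _] [r [Hr Hinv]]] [_ [G [HG HS]]] Ger. exists G. split; [exact HS|].
pose proof (subordinate_at_0 B phi G HB B0 HS) as G0.
destruct Ger as [Ev Ed Ed2 Jh J1 [b J2]].
assert (D0 : in_disk 0) by (unfold in_disk; rewrite Cmod_0; lra).
assert (g0 : g 0 = RtoC 0).
{ destruct (Hinv 0) as [_ [Hd Hfg]]; [rewrite Cmod_0; exact Hr|].
  apply Hinj; auto. rewrite Hfg. destruct Hnf as [_ [-> _]]. reflexivity. }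
destruct (analytic_has_cderiv g 0 Hga D0) as [l Hl].
destruct (has_cderiv_factor g l Hl g0) as [W [HW EW]].
assert (Efg : near0 (fun x => f (g x) = x)).
{ exists r; split; [exact Hr|]. intros x Hx. apply (Hinv x Hx). }
assert (Jf : jet f 0 1 a2 a3).
{ apply (jet_ext (fun z => z * fh z)%C).
  - eapply near0_imp; [|exact Ev]. intros z ->. reflexivity.
  - eapply jet_eq; [exact (jet_mult _ _ _ _ _ _ _ _ _ _ jet_id Jh)|..]; ring. }
assert (Jfg : jet (fun x => f (g x)) 0 1 0 0).
{ apply (jet_ext (fun x => x)); [|apply jet_id]. eapply near0_imp; [|exact Efg].
  intros x A. now rewrite A. }
destruct (jet_root f g W _ _ _ _ _ _ _ _ Jf C1_nz HW EW Jfg) as [c1 [c2 [c3 Jg]]].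
destruct (jet_unique _ _ _ _ _ _ _ _ _ (jet_comp _ _ _ _ _ _ _ _ _ Jf Jg) Jfg)
  as [_ [C1 [C2 C3]]].
assert (c1 = RtoC 1) by (apply (Ceq_of _ _ _ _ C1); ring). subst c1.
assert (c2 = - a2)%C by (apply (Ceq_of _ _ _ _ C2); ring). subst c2.
assert (c3 = 2 * a2 ^ 2 - a3)%C by (apply (Ceq_of _ _ _ _ C3); ring). subst c3.
clear C1 C2 C3.
apply (near0_comp _ g W HW EW) in Ev.
apply (near0_comp _ g W HW EW) in Ed.
apply (near0_comp _ g W HW EW) in Ed2.
assert (N1 : near0 (fun x => f1 (g x) <> RtoC 0 /\ has_cderiv g x (/ f1 (g x)))).
{ apply (near0_imp _ _) with (2 := near0_and _ _ (near0_and _ _ (near0_near _ Efg) Ed) (near0_lt 1 Rlt_0_1)).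
  intros x [[[e [He A]] Hd] Hx].
  destruct (analytic_has_cderiv g x Hga Hx) as [m Hm].
  pose proof (has_cderiv_comp f g x _ _ Hd Hm) as Hc.
  apply (has_cderiv_ext_loc _ (fun x => x) _ _ e He A) in Hc.
  apply C_derive_unique in Hc. rewrite (C_derive_unique _ _ _ (has_cderiv_id x)) in Hc.
  assert (Hne : f1 (g x) <> RtoC 0).
  { intros E. rewrite E, Cmult_0_l in Hc. exact (C1_nz Hc). }
  split; [exact Hne|].
  apply (has_cderiv_eq _ _ m); [|exact Hm].
  transitivity (/ f1 (g x) * (f1 (g x) * m))%C; [field; exact Hne|]. rewrite <- Hc. ring. }
assert (N2 : near0 (fun x => has_cderiv (fun x => / f1 (g x))%C x
   (- / (f1 (g x) * f1 (g x)) * (f2 (g x) * / f1 (g x)))%C)).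
{ apply (near0_imp _ _) with (2 := near0_and _ _ N1 Ed2).
  intros x [[A Hg] H2]. apply (has_cderiv_inv (fun x => f1 (g x))); [exact A|].
  exact (has_cderiv_comp f1 g x _ _ H2 Hg). }
assert (ED := near0_has_cderiv_C_derive g (fun x => / f1 (g x))%C _
   (near0_imp _ _ (fun x H => proj2 H) N1) N2).
pose proof (jet_comp _ _ _ _ _ _ _ _ _ Jh Jg) as Kh.
pose proof (jet_comp _ _ _ _ _ _ _ _ _ J1 Jg) as K1.
pose proof (jet_comp _ _ _ _ _ _ _ _ _ J2 Jg) as K2.
assert (E : near0 (fun x => G x * (f1 (g x) * (f1 (g x) * f1 (g x))) =
  fh (g x) * (f1 (g x) * f1 (g x)) + (- lam) * (g x * (fh (g x) * (fh (g x) * f2 (g x)))))%C).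
{ apply (near0_imp _ _) with (2 := near0_and _ _ (near0_and _ _ Ev Efg)
     (near0_and _ _ (near0_and _ _ ED N1) (near0_lt 1 Rlt_0_1))).
  intros x [[A Hfg] [[[D1 D2] [Hne _]] Hx]].
  destruct (Ceq_dec x 0) as [->|Hx0].
  - rewrite G0, g0, (jet_at_0 _ _ _ _ _ Jh), (jet_at_0 _ _ _ _ _ J1). ring.
  - destruct (HG x Hx Hx0) as [Hgx HGx]. rewrite HGx, D1, D2.
    rewrite Hfg in A.
    replace (fh (g x)) with (x / g x)%C.
    + field. split; [exact Hgx|exact Hne].
    + transitivity (g x * fh (g x) / g x)%C; [now rewrite <- A|field; exact Hgx]. }
assert (K10 : (1 * (1 * 1))%C <> RtoC 0).
{ intros Z. apply C1_nz. rewrite <- Z. ring. }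
destruct (jet_div G _ _ _ _ _ _ _ _ _ _
  (jet_mult _ _ _ _ _ _ _ _ _ _ K1 (jet_mult _ _ _ _ _ _ _ _ _ _ K1 K1)) K10
  (jet_plus _ _ _ _ _ _ _ _ _ _
    (jet_mult _ _ _ _ _ _ _ _ _ _ Kh (jet_mult _ _ _ _ _ _ _ _ _ _ K1 K1))
    (jet_scal (- lam) _ _ _ _ _
      (jet_mult _ _ _ _ _ _ _ _ _ _ Jg (jet_mult _ _ _ _ _ _ _ _ _ _ Kh
         (jet_mult _ _ _ _ _ _ _ _ _ _ Kh K2))))) E)
  as [d0 [d1 [d2 [d3 [JG [E0 [E1 [E2 E3]]]]]]]].
assert (d0 = RtoC 1) by (apply (Ceq_of _ _ _ _ E0); ring). subst d0.
assert (d1 = st1 lam (- a2)) by (apply (Ceq_of _ _ _ _ E1); unfold st1; ring). subst d1.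
assert (d2 = st2 lam (- a2) (2 * a2 ^ 2 - a3))
  by (apply (Ceq_of _ _ _ _ E2); unfold st1, st2; ring). subst d2.
assert (d3 = st3 lam (- a2) (2 * a2 ^ 2 - a3) (- (5 * a2 ^ 3 - 5 * a2 * a3 + a4)))
  by (apply (Ceq_of _ _ _ _ E3); unfold st1, st2, st3; ring). subst d3.
exact JG.
Qed.

(** * The coefficient relations and their consequences *)

(** The coefficients of [phi o w] in terms of those of [(1 + w) / (1 - w)]. *)
Record coefficient_relations (lam B1 : R) (B2 B3 a2 a3 a4 c1 c2 c3 : C) : Prop := {
  rel1 : st1 lam a2 = (B1 * c1 / 2)%C;
  rel2 : st2 lam a2 a3 = (B1 * c2 / 2 + (B2 - B1) * c1 ^ 2 / 4)%C;
  rel3 : st3 lam a2 a3 a4 = (B1 * c3 / 2 + (B2 - B1) * c1 * c2 / 2 + (B1 + B3 - 2 * B2) * c1 ^ 3 / 8)%C }.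

Lemma RtoC_neq_0 (r : R) : r <> 0 -> RtoC r <> RtoC 0.
Proof. intros H E. apply H. now apply RtoC_inj in E. Qed.

Lemma RtoC_affine (k lam : R) : (1 + RtoC k * RtoC lam)%C = RtoC (1 + k * lam).
Proof. now rewrite RtoC_plus, RtoC_mult. Qed.

Lemma subordinate_relations (lam B1 : R) (B2 B3 a2 a3 a4 u1 u2 u3 : C) :
  (st1 lam a2 = B1 * u1)%C -> (st2 lam a2 a3 = B1 * u2 + B2 * u1 ^ 2)%C ->
  (st3 lam a2 a3 a4 = B1 * u3 + 2 * B2 * u1 * u2 + B3 * u1 ^ 3)%C ->
  coefficient_relations lam B1 B2 B3 a2 a3 a4 (cayley1 u1) (cayley2 u1 u2) (cayley3 u1 u2 u3).
Proof.
intros E1 E2 E3. constructor; [rewrite E1|rewrite E2|rewrite E3]; unfold cayley1, cayley2, cayley3; field.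
Qed.

Section Identities.
Variables lam B1 : R.
Variables B2 B3 a2 a3 a4 c1 c2 c3 b1 b2 b3 : C.
Hypothesis lam_ge0 : 0 <= lam.
Hypothesis B1_gt0 : 0 < B1.
Hypothesis Hf : coefficient_relations lam B1 B2 B3 a2 a3 a4 c1 c2 c3.
Hypothesis Hg : coefficient_relations lam B1 B2 B3 (- a2) (2 * a2 ^ 2 - a3)
  (- (5 * a2 ^ 3 - 5 * a2 * a3 + a4)) b1 b2 b3.

Notation D := (coefD lam B1 B2).
Notation E := (coefE lam B1 B2).

Lemma one_plus_2lam_neq_0 : (1 + 2 * lam)%C <> RtoC 0.
Proof. rewrite RtoC_affine. apply RtoC_neq_0. lra. Qed.
Lemma one_plus_3lam_neq_0 : (1 + 3 * lam)%C <> RtoC 0.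
Proof. rewrite RtoC_affine. apply RtoC_neq_0. lra. Qed.
Lemma B1_neq_0 : RtoC B1 <> RtoC 0.
Proof. apply RtoC_neq_0. lra. Qed.

Lemma a2_c1 : a2 = (B1 * c1 / (2 * (1 + 2 * lam)))%C.
Proof.
destruct Hf as [H _ _]. unfold st1 in H.
transitivity ((1 + 2 * lam) * a2 / (1 + 2 * lam))%C; [field; exact one_plus_2lam_neq_0|].
rewrite H. field. exact one_plus_2lam_neq_0.
Qed.

Lemma b1_c1 : b1 = (- c1)%C.
Proof.
destruct Hf as [H _ _]. destruct Hg as [G _ _]. unfold st1 in H, G.
transitivity (2 / B1 * (B1 * b1 / 2))%C; [field; exact B1_neq_0|]. rewrite <- G.
transitivity (- (2 / B1 * ((1 + 2 * lam) * a2)))%C; [field; exact B1_neq_0|]. rewrite H.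
field. exact B1_neq_0.
Qed.

(** Adding the second relations for [f] and [g] eliminates [a3] and leaves [a2^2]. *)
Lemma c1_sqr : (D * c1 ^ 2 = (1 + 2 * lam) ^ 2 * B1 * (c2 + b2))%C.
Proof.
destruct Hf as [_ H _]. destruct Hg as [_ G _]. rewrite b1_c1 in G.
rewrite a2_c1 in H, G. unfold st2 in H, G. pose proof one_plus_2lam_neq_0. pose proof B1_neq_0.
assert (T : (B1 * c2 / 2 + (B2 - B1) * c1 ^ 2 / 4 + (B1 * b2 / 2 + (B2 - B1) * (- c1) ^ 2 / 4)
   = 2 * (1 + 4 * lam) * (B1 * c1 / (2 * (1 + 2 * lam))) ^ 2)%C).
{ rewrite <- H, <- G. field. assumption. }
unfold coefD.
transitivity ((1 + 2 * lam) ^ 2 * (2 * (2 * (1 + 4 * lam) * (B1 * c1 / (2 * (1 + 2 * lam))) ^ 2)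
   + (B1 - B2) * c1 ^ 2))%C; [field; assumption|]. rewrite <- T. field.
Qed.

(** Subtracting the second relations for [f] and [g] eliminates the terms in [c1^2]. *)
Lemma a3_formula : a3 = (a2 ^ 2 + B1 * (c2 - b2) / (8 * (1 + 3 * lam)))%C.
Proof.
destruct Hf as [_ H _]. destruct Hg as [_ G _]. rewrite b1_c1 in G.
unfold st2 in H, G. pose proof one_plus_3lam_neq_0.
assert (T : (4 * (1 + 3 * lam) * (a3 - a2 ^ 2) = B1 * (c2 - b2) / 2)%C).
{ transitivity ((B1 * c2 / 2 + (B2 - B1) * c1 ^ 2 / 4) - (B1 * b2 / 2 + (B2 - B1) * (- c1) ^ 2 / 4))%C;
   [|field]. rewrite <- H, <- G. ring. }
transitivity (a2 ^ 2 + 4 * (1 + 3 * lam) * (a3 - a2 ^ 2) / (4 * (1 + 3 * lam)))%C; [field; assumption|].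
rewrite T. field. assumption.
Qed.

Lemma a4_formula : (3 * (1 + 4 * lam) * a4 = (2 + 6 * lam) * a2 ^ 3
  + (3 + 8 * lam) * a2 * (B1 * (c2 - b2) / (8 * (1 + 3 * lam)))
  + (B1 * c3 / 2 + (B2 - B1) * c1 * c2 / 2 + (B1 + B3 - 2 * B2) * c1 ^ 3 / 8))%C.
Proof.
destruct Hf as [_ _ H]. rewrite <- H. unfold st3. rewrite a3_formula. pose proof one_plus_3lam_neq_0. field. assumption.
Qed.

(** Adding the third relations for [f] and [g] eliminates [a4] and the terms in [c1^3];
    what remains is a multiple of [a2 * (a3 - a2^2)]. *)
Lemma c1_E : (E * (c1 * (c2 - b2)) = 8 * (1 + 2 * lam) * (1 + 3 * lam) * B1 * (c3 + b3))%C.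
Proof.
destruct Hf as [_ _ H]. destruct Hg as [_ _ G]. rewrite b1_c1 in G. unfold st3 in H, G.
pose proof one_plus_3lam_neq_0. pose proof one_plus_2lam_neq_0.
assert (T : ((9 + 44 * lam) * a2 * (B1 * (c2 - b2) / (8 * (1 + 3 * lam)))
   = B1 * (c3 + b3) / 2 + (B2 - B1) * c1 * (c2 - b2) / 2)%C).
{ transitivity ((B1 * c3 / 2 + (B2 - B1) * c1 * c2 / 2 + (B1 + B3 - 2 * B2) * c1 ^ 3 / 8)
   + (B1 * b3 / 2 + (B2 - B1) * (- c1) * b2 / 2 + (B1 + B3 - 2 * B2) * (- c1) ^ 3 / 8))%C; [|field].
  rewrite <- H, <- G. rewrite a3_formula. field. assumption. }
rewrite a2_c1 in T.
transitivity (16 * (1 + 2 * lam) * (1 + 3 * lam) * ((9 + 44 * lam) * (B1 * c1 / (2 * (1 + 2 * lam))) * (B1 * (c2 - b2) / (8 * (1 + 3 * lam)))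
  - (B2 - B1) * c1 * (c2 - b2) / 2))%C.
- unfold coefE. field. split; assumption.
- rewrite T. field.
Qed.

Notation a3_weight_c := ((3 + 10 * lam) * B1 ^ 2 + (B1 - B2) * (1 + 2 * lam) ^ 2)%C.
Notation a3_weight_b := ((1 + 2 * lam) * B1 ^ 2 - (1 + 2 * lam) ^ 2 * (B1 - B2))%C.

(** Both [a2^2], through [c1_sqr], and [a3 - a2^2] are linear in [c2] and [b2]. *)
Lemma a3_D : (8 * (1 + 3 * lam) * D * a3 = B1 * (c2 * a3_weight_c + b2 * a3_weight_b))%C.
Proof.
pose proof one_plus_2lam_neq_0 as H2. pose proof one_plus_3lam_neq_0 as H3.
rewrite a3_formula, a2_c1.
transitivity (2 * (1 + 3 * lam) * B1 ^ 2 / (1 + 2 * lam) ^ 2 * (D * c1 ^ 2) + D * B1 * (c2 - b2))%C.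
- field. split; assumption.
- rewrite c1_sqr. unfold coefD. field. assumption.
Qed.

(** The second relation for [f] alone. *)
Lemma a3_direct : (2 * (1 + 3 * lam) * a3 = c1 ^ 2 / (4 * (1 + 2 * lam) ^ 2) * a3_weight_b + B1 * c2 / 2)%C.
Proof.
pose proof one_plus_2lam_neq_0 as H2. destruct Hf as [_ H _]. unfold st2 in H.
transitivity ((B1 * c2 / 2 + (B2 - B1) * c1 ^ 2 / 4) + (1 + 2 * lam) * a2 ^ 2)%C.
- rewrite <- H. ring.
- rewrite a2_c1. field. assumption.
Qed.

(** Trading [B2] for [coefD] makes the latter an indeterminate, so that the identities
    with [coefD] in a denominator become rational identities. *)
Lemma B2_from_D : B2 = (B1 + ((1 + 4 * lam) * B1 ^ 2 - D) / (1 + 2 * lam) ^ 2)%C.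
Proof. unfold coefD. field. exact one_plus_2lam_neq_0. Qed.

Lemma b2_from_c : b2 = (D * c1 ^ 2 / ((1 + 2 * lam) ^ 2 * B1) - c2)%C.
Proof. rewrite c1_sqr. field. split; [exact B1_neq_0|exact one_plus_2lam_neq_0]. Qed.

(** [c1^3] is [c1] times a multiple of [c2 + b2] by [c1_sqr], so [a4_formula] is linear in
    [c3], [c1 * c2] and [c1 * b2]. *)
Lemma a4_from_A_and_C : D <> RtoC 0 ->
  (3 * (1 + 4 * lam) * a4 = B1 * c3 / 2
   + c1 / 2 * (coefA lam B1 B2 B3 * c2 + coefC lam B1 B2 B3 * b2))%C.
Proof.
intros HD. pose proof one_plus_2lam_neq_0. pose proof one_plus_3lam_neq_0. pose proof B1_neq_0.
rewrite a4_formula, a2_c1. unfold coefA, coefC.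
rewrite b2_from_c. generalize B2_from_D. revert HD. generalize D. intros d Hd EB.
generalize (B1 + B3 - 2 * B2)%C. intros k. rewrite EB. field. auto.
Qed.

Notation a4_weight_c1 := ((B2 - B1) + B1 * (2 * (1 + 3 * lam) * B1 ^ 3
                            + (1 + 2 * lam) ^ 3 * (B1 + B3 - 2 * B2)) / (2 * (1 + 2 * lam) * D))%C.
Notation a4_weight_c := ((12 + 52 * lam) * B1 ^ 2 - 4 * (1 + 2 * lam) * (1 + 3 * lam) * (B2 - B1))%C.
Notation a4_weight_b := ((3 + 8 * lam) * B1 ^ 2 + 4 * (1 + 2 * lam) * (1 + 3 * lam) * (B2 - B1))%C.

(** As for [a4_from_A_and_C], but in terms of [c1 * (c2 + b2)] and [c1 * (c2 - b2)], the
    latter being a multiple of [c3 + b3] by [c1_E]. *)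
Lemma a4_from_E : D <> RtoC 0 -> E <> RtoC 0 ->
  (3 * (1 + 4 * lam) * a4 = B1 / (2 * E) * (c3 * a4_weight_c + b3 * a4_weight_b) + c1 / 4 * (c2 + b2) * a4_weight_c1)%C.
Proof.
intros HD HE. pose proof one_plus_2lam_neq_0 as H2. pose proof one_plus_3lam_neq_0 as H3. pose proof B1_neq_0 as HB.
assert (EE : (c1 * (c2 - b2) = 8 * (1 + 2 * lam) * (1 + 3 * lam) * B1 * (c3 + b3) / E)%C).
{ rewrite <- c1_E. field. exact HE. }
assert (T : (3 * (1 + 4 * lam) * a4 = B1 * c3 / 2
  + c1 * (c2 - b2) * a4_weight_b / (16 * (1 + 2 * lam) * (1 + 3 * lam)) + c1 / 4 * (c2 + b2) * a4_weight_c1)%C).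
{ rewrite a4_formula, a2_c1.
  rewrite b2_from_c. generalize B2_from_D. revert HD. generalize D. intros d Hd EB.
  generalize (B1 + B3 - 2 * B2)%C. intros k. rewrite EB. field. auto. }
rewrite T, EE.
generalize a4_weight_c1. intros w.
transitivity (B1 / (2 * E) * (c3 * E + (c3 + b3) * a4_weight_b) + c1 / 4 * (c2 + b2) * w)%C.
- field. auto.
- replace (c3 * E + (c3 + b3) * a4_weight_b)%C with (c3 * a4_weight_c + b3 * a4_weight_b)%C by (unfold coefE; ring). reflexivity.
Qed.

Hypothesis Bc1 : Cmod c1 <= 2.
Hypothesis Bc2 : Cmod c2 <= 2.
Hypothesis Bc3 : Cmod c3 <= 2.
Hypothesis Bb2 : Cmod b2 <= 2.
Hypothesis Bb3 : Cmod b3 <= 2.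

Lemma Cmod_scal_pos (r : R) (z : C) : 0 <= r -> Cmod (RtoC r * z) = r * Cmod z.
Proof. intros H. now rewrite Cmod_mult, Cmod_R, Rabs_pos_eq. Qed.

Lemma Cmod_comb_le (x y P Q : C) : Cmod x <= 2 -> Cmod y <= 2 ->
  Cmod (x * P + y * Q) <= 2 * (Cmod P + Cmod Q).
Proof.
intros Hx Hy. eapply Rle_trans; [apply Cmod_triangle|]. rewrite !Cmod_mult.
pose proof (Cmod_ge_0 P). pose proof (Cmod_ge_0 Q). nra.
Qed.

Lemma Cmod_sum_le (x y : C) : Cmod x <= 2 -> Cmod y <= 2 -> Cmod (x + y) <= 4.
Proof. intros Hx Hy. eapply Rle_trans; [apply Cmod_triangle|]. lra. Qed.

Lemma a2_Cmod : Cmod a2 = B1 / (2 * (1 + 2 * lam)) * Cmod c1.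
Proof.
rewrite <- Cmod_scal_pos.
- f_equal. rewrite a2_c1, RtoC_div, !RtoC_mult, RtoC_plus, RtoC_mult by lra.
  field. exact one_plus_2lam_neq_0.
- apply Rmult_le_pos; [lra|]. left. apply Rinv_0_lt_compat. lra.
Qed.

Lemma c1_sqr_bound : Cmod D * Cmod c1 ^ 2 <= 4 * (1 + 2 * lam) ^ 2 * B1.
Proof.
rewrite <- Cmod_pow, <- Cmod_mult, c1_sqr.
replace ((1 + 2 * lam) ^ 2 * B1 * (c2 + b2))%C with (RtoC ((1 + 2 * lam) ^ 2 * B1) * (c2 + b2))%C
  by (rewrite RtoC_mult, RtoC_pow, RtoC_plus, RtoC_mult; reflexivity).
assert (0 <= (1 + 2 * lam) ^ 2 * B1) by (apply Rmult_le_pos; [apply pow2_ge_0|lra]).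
rewrite Cmod_scal_pos by assumption.
pose proof (Cmod_sum_le c2 b2 Bc2 Bb2). nra.
Qed.

Lemma c1_bound : D <> RtoC 0 -> Cmod c1 <= 2 * (1 + 2 * lam) * sqrt B1 / sqrt (Cmod D).
Proof.
intros HD. apply Cmod_gt_0 in HD.
pose proof (sqrt_lt_R0 _ HD) as Hs. pose proof (sqrt_lt_R0 _ B1_gt0) as HsB.
pose proof c1_sqr_bound as H.
apply Rmult_le_reg_r with (sqrt (Cmod D)); [exact Hs|].
unfold Rdiv. rewrite Rmult_assoc, Rinv_l, Rmult_1_r by lra.
apply Rsqr_incr_0_var.
- unfold Rsqr.
  replace (Cmod c1 * sqrt (Cmod D) * (Cmod c1 * sqrt (Cmod D)))
    with (sqrt (Cmod D) * sqrt (Cmod D) * Cmod c1 ^ 2) by ring.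
  replace (2 * (1 + 2 * lam) * sqrt B1 * (2 * (1 + 2 * lam) * sqrt B1))
    with (4 * (1 + 2 * lam) ^ 2 * (sqrt B1 * sqrt B1)) by ring.
  rewrite !sqrt_sqrt by lra. exact H.
- repeat apply Rmult_le_pos; lra.
Qed.

Lemma a3_bound_D : D <> RtoC 0 ->
  Cmod a3 <= B1 / (4 * (1 + 3 * lam) * Cmod D) * (Cmod a3_weight_c + Cmod a3_weight_b).
Proof.
intros HD. pose proof HD as HD'. apply Cmod_gt_0 in HD'.
assert (H : 8 * (1 + 3 * lam) * Cmod D * Cmod a3 <= B1 * (2 * (Cmod a3_weight_c + Cmod a3_weight_b))).
{ replace (8 * (1 + 3 * lam) * Cmod D * Cmod a3) with (Cmod (8 * (1 + 3 * lam) * D * a3)).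
  - rewrite a3_D, Cmod_scal_pos by lra. apply Rmult_le_compat_l; [lra|].
    now apply Cmod_comb_le.
  - rewrite !Cmod_mult. rewrite RtoC_affine, !Cmod_R, !Rabs_pos_eq by lra. reflexivity. }
apply Rmult_le_reg_l with (8 * (1 + 3 * lam) * Cmod D).
- apply Rmult_lt_0_compat; lra.
- eapply Rle_trans; [exact H|]. right. field. lra.
Qed.

Lemma a3_bound_direct :
  Cmod a3 <= (Cmod c1 ^ 2 / (4 * (1 + 2 * lam) ^ 2) * Cmod a3_weight_b + B1) / (2 * (1 + 3 * lam)).
Proof.
apply Rmult_le_reg_l with (2 * (1 + 3 * lam)); [lra|].
replace (2 * (1 + 3 * lam) * Cmod a3) with (Cmod (2 * (1 + 3 * lam) * a3)).
- rewrite a3_direct. eapply Rle_trans; [apply Cmod_triangle|].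
  replace (2 * (1 + 3 * lam) * ((Cmod c1 ^ 2 / (4 * (1 + 2 * lam) ^ 2) * Cmod a3_weight_b + B1) / (2 * (1 + 3 * lam))))
    with (Cmod c1 ^ 2 / (4 * (1 + 2 * lam) ^ 2) * Cmod a3_weight_b + B1) by (field; lra).
  apply Rplus_le_compat.
  + rewrite Cmod_mult, Cmod_div, !Cmod_mult, !Cmod_pow, RtoC_affine, !Cmod_R, !Rabs_pos_eq
      by (lra || (apply Cmult_neq_0; [apply RtoC_neq_0; lra|apply Cpow_nz, one_plus_2lam_neq_0])).
    lra.
  + replace (B1 * c2 / 2)%C with (RtoC (B1 / 2) * c2)%C by (rewrite RtoC_div by lra; field).
    rewrite Cmod_scal_pos by lra. nra.
- rewrite !Cmod_mult. rewrite RtoC_affine, !Cmod_R, !Rabs_pos_eq by lra. reflexivity.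
Qed.

Lemma a4_Cmod : Cmod (3 * (1 + 4 * lam) * a4) = 3 * (1 + 4 * lam) * Cmod a4.
Proof. rewrite !Cmod_mult. rewrite RtoC_affine, !Cmod_R, !Rabs_pos_eq by lra. reflexivity. Qed.

Lemma a4_bound_A_and_C : D <> RtoC 0 ->
  Cmod a4 <= B1 / (3 * (1 + 4 * lam))
    + Cmod c1 / (3 * (1 + 4 * lam)) * (Cmod (coefA lam B1 B2 B3) + Cmod (coefC lam B1 B2 B3)).
Proof.
intros HD. apply Rmult_le_reg_l with (3 * (1 + 4 * lam)); [lra|].
rewrite <- a4_Cmod, a4_from_A_and_C by exact HD.
set (A := coefA lam B1 B2 B3). set (C0 := coefC lam B1 B2 B3).
replace (3 * (1 + 4 * lam) * (B1 / (3 * (1 + 4 * lam)) + Cmod c1 / (3 * (1 + 4 * lam)) * (Cmod A + Cmod C0)))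
  with (B1 + Cmod c1 / 2 * (2 * (Cmod A + Cmod C0))) by (field; lra).
eapply Rle_trans; [apply Cmod_triangle|]. apply Rplus_le_compat.
- replace (B1 * c3 / 2)%C with (RtoC (B1 / 2) * c3)%C by (rewrite RtoC_div by lra; field).
  rewrite Cmod_scal_pos by lra. nra.
- rewrite Cmod_mult, Cmod_div, Cmod_R, Rabs_pos_eq by (lra || (apply RtoC_neq_0; lra)).
  apply Rmult_le_compat_l; [pose proof (Cmod_ge_0 c1); lra|].
  rewrite (Cmult_comm A), (Cmult_comm C0). now apply Cmod_comb_le.
Qed.

Lemma a4_bound_E : D <> RtoC 0 -> E <> RtoC 0 ->
  Cmod a4 <= 2 * B1 / (6 * (1 + 4 * lam) * Cmod E) * (Cmod a4_weight_c + Cmod a4_weight_b)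
    + Cmod c1 / (3 * (1 + 4 * lam)) * Cmod a4_weight_c1.
Proof.
intros HD HE. pose proof HE as HE'. apply Cmod_gt_0 in HE'.
apply Rmult_le_reg_l with (3 * (1 + 4 * lam)); [lra|].
rewrite <- a4_Cmod, a4_from_E by assumption.
generalize a4_weight_c a4_weight_b a4_weight_c1. intros P Q W.
replace (3 * (1 + 4 * lam) * (2 * B1 / (6 * (1 + 4 * lam) * Cmod E) * (Cmod P + Cmod Q)
    + Cmod c1 / (3 * (1 + 4 * lam)) * Cmod W))
  with (B1 / (2 * Cmod E) * (2 * (Cmod P + Cmod Q)) + Cmod c1 / 4 * 4 * Cmod W) by (field; lra).
eapply Rle_trans; [apply Cmod_triangle|]. apply Rplus_le_compat.
- rewrite Cmod_mult, Cmod_div, Cmod_mult, !Cmod_R, !Rabs_pos_eq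
    by (lra || (apply Cmult_neq_0; [apply RtoC_neq_0; lra|exact HE])).
  apply Rmult_le_compat_l; [|now apply Cmod_comb_le].
  apply Rmult_le_pos; [lra|]. left. apply Rinv_0_lt_compat. lra.
- rewrite !Cmod_mult, Cmod_div, Cmod_R, Rabs_pos_eq by (lra || (apply RtoC_neq_0; lra)).
  apply Rmult_le_compat_r; [apply Cmod_ge_0|].
  apply Rmult_le_compat_l; [pose proof (Cmod_ge_0 c1); lra|]. now apply Cmod_sum_le.
Qed.
End Identities.

(** * The coefficient bounds *)

Lemma le_min_pair x d1 e1 d2 e2 : (d1 <> RtoC 0 -> x <= e1) -> (d2 <> RtoC 0 -> x <= e2) ->
  le_min x [(d1, e1); (d2, e2)].
Proof. intros H1 H2 d e [H|[H|[]]] Hd; injection H as <- <-; auto. Qed.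

Theorem theorem2p2 (lam : R) (phi : C -> C) (B : nat -> C) (B1 : R)
    (f : C -> C) (a : nat -> C)
    (hlam : 0 <= lam)
    (hphi : univalent phi)
    (hphi_re : forall z : C, in_disk z -> 0 < Re (phi z))
    (hphi_B : taylor B phi)
    (hB0 : B 0%nat = RtoC 1)
    (hB1 : B 1%nat = RtoC B1)
    (hB1_pos : 0 < B1)
    (hf : ST_sigma lam phi f)
    (hf_a : taylor a f)
    (ha0 : a 0%nat = RtoC 0)
    (ha1 : a 1%nat = RtoC 1) :
  let B2 := B 2%nat in
  let B3 := B 3%nat in
  let D := coefD lam B1 B2 in
  let E := coefE lam B1 B2 in
  let A := coefA lam B1 B2 B3 in
  let C0 := coefC lam B1 B2 B3 in
  ((1 + 2 * lam) ^ 2 * B1 <= Cmod D ->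
     Cmod (a 2%nat) <= B1 * sqrt B1 / sqrt (Cmod D) /\
     le_min (Cmod (a 3%nat))
       [ (D,
          B1 / (4 * (1 + 3 * lam) * Cmod D)
          * (Cmod ((3 + 10 * lam) * B1 ^ 2 + (B1 - B2) * (1 + 2 * lam) ^ 2)
             + Cmod ((1 + 2 * lam) * B1 ^ 2 - (1 + 2 * lam) ^ 2 * (B1 - B2))));
         (D,
          B1 / (2 * (1 + 3 * lam) * Cmod D)
          * (Cmod ((1 + 2 * lam) * B1 ^ 2 - (1 + 2 * lam) ^ 2 * (B1 - B2))
             + Cmod D)) ] /\
     le_min (Cmod (a 4%nat))
       [ (D,
          B1 / (3 * (1 + 4 * lam))
          + 2 * sqrt B1 * (1 + 2 * lam) / (3 * (1 + 4 * lam) * sqrt (Cmod D))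
            * (Cmod A + Cmod C0));
         ((D * E)%C,
          2 * B1 / (6 * (1 + 4 * lam) * Cmod E)
          * (Cmod ((12 + 52 * lam) * B1 ^ 2
                   - 4 * (1 + 2 * lam) * (1 + 3 * lam) * (B2 - B1))
             + Cmod ((3 + 8 * lam) * B1 ^ 2
                     + 4 * (1 + 2 * lam) * (1 + 3 * lam) * (B2 - B1)))
          + 2 * (1 + 2 * lam) * sqrt B1 / (3 * (1 + 4 * lam) * sqrt (Cmod D))
            * Cmod ((B2 - B1)
                    + B1 * (2 * (1 + 3 * lam) * B1 ^ 3
                            + (1 + 2 * lam) ^ 3 * (B1 + B3 - 2 * B2))
                      / (2 * (1 + 2 * lam) * D))) ])
  /\
  ((1 + 2 * lam) ^ 2 * B1 >= Cmod D ->
     Cmod (a 2%nat) <= B1 / (1 + 2 * lam) /\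
     le_min (Cmod (a 3%nat))
       [ (D,
          B1 / (4 * (1 + 3 * lam) * Cmod D)
          * (Cmod ((3 + 10 * lam) * B1 ^ 2 + (B1 - B2) * (1 + 2 * lam) ^ 2)
             + Cmod ((1 + 2 * lam) * B1 ^ 2 - (1 + 2 * lam) ^ 2 * (B1 - B2))));
         (RtoC 1,
          1 / (2 * (1 + 3 * lam) * (1 + 2 * lam))
          * (Cmod (B1 ^ 2 - (1 + 2 * lam) * (B1 - B2))
             + (1 + 2 * lam) * B1)) ] /\
     le_min (Cmod (a 4%nat))
       [ (D,
          B1 / (3 * (1 + 4 * lam))
          + 2 / (3 * (1 + 4 * lam)) * (Cmod A + Cmod C0));
         ((D * E)%C,
          2 * B1 / (6 * (1 + 4 * lam) * Cmod E)
          * (Cmod ((12 + 52 * lam) * B1 ^ 2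
                   - 4 * (1 + 2 * lam) * (1 + 3 * lam) * (B2 - B1))
             + Cmod ((3 + 8 * lam) * B1 ^ 2
                     + 4 * (1 + 2 * lam) * (1 + 3 * lam) * (B2 - B1)))
          + 2 / (3 * (1 + 4 * lam))
            * Cmod ((B2 - B1)
                    + B1 * (2 * (1 + 3 * lam) * B1 ^ 3
                            + (1 + 2 * lam) ^ 3 * (B1 + B3 - 2 * B2))
                      / (2 * (1 + 2 * lam) * D))) ]).
Proof.
intros B2 B3 D E A C0.
destruct hf as [[Hnf [Huf _]] [Hstf [g [Hinv Hstg]]]].
destruct (taylor_germ a f hf_a ha0 ha1) as [fh [f1 [f2 Ger]]].
destruct (ST_jet lam phi B f _ _ _ _ _ _ hphi_B hB0 Hstf Ger) as [F [SF JF]].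
destruct (ST_inverse_jet lam phi B f g _ _ _ _ _ _ hphi_B hB0 Hnf Huf Hinv Hstg Ger) as [G [SG JG]].
destruct (subordinate_coefficients B B1 phi F _ _ _ _ hphi_B hB1 hB1_pos SF JF)
  as [u1 [u2 [u3 [[U1 [U2 U3]] [EF1 [EF2 EF3]]]]]].
destruct (subordinate_coefficients B B1 phi G _ _ _ _ hphi_B hB1 hB1_pos SG JG)
  as [v1 [v2 [v3 [[_ [V2 V3]] [EG1 [EG2 EG3]]]]]].
pose proof (subordinate_relations _ _ _ _ _ _ _ _ _ _ EF1 EF2 EF3) as RF.
pose proof (subordinate_relations _ _ _ _ _ _ _ _ _ _ EG1 EG2 EG3) as RG.
fold B2 B3 in RF, RG.
clear EF1 EF2 EF3 EG1 EG2 EG3 SF JF SG JG Ger Hinv Hstf Hstg.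
pose proof (a2_Cmod _ _ _ _ _ _ _ _ _ _ hlam hB1_pos RF) as M2.
pose proof (c1_bound _ _ _ _ _ _ _ _ _ _ _ _ _ hlam hB1_pos RF RG U2 V2) as T.
pose proof (c1_sqr_bound _ _ _ _ _ _ _ _ _ _ _ _ _ hlam hB1_pos RF RG U2 V2) as T2.
pose proof (a3_bound_D _ _ _ _ _ _ _ _ _ _ _ _ _ hlam hB1_pos RF RG U2 V2) as A3.
pose proof (a3_bound_direct _ _ _ _ _ _ _ _ _ _ hlam hB1_pos RF U2) as A3'.
pose proof (a4_bound_A_and_C _ _ _ _ _ _ _ _ _ _ _ _ _ hlam hB1_pos RF RG U2 U3 V2) as A4.
pose proof (a4_bound_E _ _ _ _ _ _ _ _ _ _ _ _ _ hlam hB1_pos RF RG U2 U3 V2 V3) as A4'.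
fold D in T, T2, A3, A4, A4'. fold E in A4'. fold A in A4. fold C0 in A4.
set (t := Cmod (cayley1 u1)) in *.
assert (Ht : 0 <= t) by apply Cmod_ge_0.
assert (L2 : 0 < 1 + 2 * lam) by lra.
assert (L3 : 0 < 1 + 3 * lam) by lra.
assert (L4 : 0 < 1 + 4 * lam) by lra.
set (Y3 := Cmod ((1 + 2 * lam) * B1 ^ 2 - (1 + 2 * lam) ^ 2 * (B1 - B2))) in *.
assert (HY3 : 0 <= Y3) by apply Cmod_ge_0.
assert (HAC : 0 <= Cmod A + Cmod C0) by (pose proof (Cmod_ge_0 A); pose proof (Cmod_ge_0 C0); lra).
match type of A4' with _ -> _ -> _ <= _ + _ * Cmod ?w => set (W4 := Cmod w) in * end.
assert (HW4 : 0 <= W4) by apply Cmod_ge_0.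
assert (Mono : forall s x, t <= s -> 0 <= x -> t / (3 * (1 + 4 * lam)) * x <= s / (3 * (1 + 4 * lam)) * x).
{ intros s x Hs Hx. apply Rmult_le_compat_r; [exact Hx|].
  apply Rmult_le_compat_r; [left; apply Rinv_0_lt_compat; lra|exact Hs]. }
split; intros Hcase.
- assert (HD : 0 < Cmod D).
  { eapply Rlt_le_trans; [|exact Hcase]. apply Rmult_lt_0_compat; [apply pow_lt; lra|lra]. }
  assert (Dne : D <> RtoC 0) by now apply Cmod_gt_0.
  specialize (T Dne). pose proof (sqrt_lt_R0 _ HD) as Hs.
  set (s := 2 * (1 + 2 * lam) * sqrt B1 / sqrt (Cmod D)) in T.
  split; [|split].
  + rewrite M2. apply Rle_trans with (B1 / (2 * (1 + 2 * lam)) * s).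
    * apply Rmult_le_compat_l; [|exact T]. apply Rmult_le_pos; [lra|].
      left; apply Rinv_0_lt_compat; lra.
    * right. unfold s. field. lra.
  + apply le_min_pair; intros Hd.
    * exact (A3 Dne).
    * eapply Rle_trans; [exact A3'|].
      replace (B1 / (2 * (1 + 3 * lam) * Cmod D) * (Y3 + Cmod D))
        with ((4 * (1 + 2 * lam) ^ 2 * B1 / Cmod D / (4 * (1 + 2 * lam) ^ 2) * Y3 + B1) / (2 * (1 + 3 * lam)))
        by (field; lra).
      apply Rmult_le_compat_r; [left; apply Rinv_0_lt_compat; lra|].
      apply Rplus_le_compat_r. apply Rmult_le_compat_r; [exact HY3|].
      apply Rmult_le_compat_r.
      { left; apply Rinv_0_lt_compat. apply Rmult_lt_0_compat; [lra|]. apply pow_lt; lra. }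
      apply Rmult_le_reg_l with (Cmod D); [exact HD|].
      eapply Rle_trans; [exact T2|]. right. field. lra.
  + apply le_min_pair; intros Hd.
    * eapply Rle_trans; [exact (A4 Dne)|]. apply Rplus_le_compat_l.
      eapply Rle_trans; [apply (Mono s); [exact T|exact HAC]|].
      right. unfold s. field. lra.
    * assert (Ene : E <> RtoC 0) by (intros Z; apply Hd; rewrite Z; ring).
      eapply Rle_trans; [exact (A4' Dne Ene)|]. apply Rplus_le_compat_l.
      eapply Rle_trans; [apply (Mono s); [exact T|exact HW4]|].
      right. unfold s. field. lra.
- split; [|split].
  + rewrite M2. apply Rle_trans with (B1 / (2 * (1 + 2 * lam)) * 2).
    * apply Rmult_le_compat_l; [|exact U1]. apply Rmult_le_pos; [lra|].
      left; apply Rinv_0_lt_compat; lra.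
    * right. field. lra.
  + apply le_min_pair; intros Hd.
    * exact (A3 Hd).
    * eapply Rle_trans; [exact A3'|].
      assert (EY : Y3 = (1 + 2 * lam) * Cmod (B1 ^ 2 - (1 + 2 * lam) * (B1 - B2))).
      { rewrite <- Cmod_scal_pos by lra. unfold Y3. f_equal. rewrite <- RtoC_affine. ring. }
      set (Z := Cmod (B1 ^ 2 - (1 + 2 * lam) * (B1 - B2))) in *.
      replace (1 / (2 * (1 + 3 * lam) * (1 + 2 * lam)) * (Z + (1 + 2 * lam) * B1))
        with ((2 ^ 2 / (4 * (1 + 2 * lam) ^ 2) * Y3 + B1) / (2 * (1 + 3 * lam)))
        by (rewrite EY; field; lra).
      apply Rmult_le_compat_r; [left; apply Rinv_0_lt_compat; lra|].
      apply Rplus_le_compat_r. apply Rmult_le_compat_r; [exact HY3|].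
      apply Rmult_le_compat_r.
      { left; apply Rinv_0_lt_compat. apply Rmult_lt_0_compat; [lra|]. apply pow_lt; lra. }
      apply pow_incr. split; [exact Ht|exact U1].
  + apply le_min_pair; intros Hd.
    * eapply Rle_trans; [exact (A4 Hd)|]. apply Rplus_le_compat_l.
      apply (Mono 2); [exact U1|exact HAC].
    * assert (Dne : D <> RtoC 0) by (intros Z; apply Hd; rewrite Z; ring).
      assert (Ene : E <> RtoC 0) by (intros Z; apply Hd; rewrite Z; ring).
      eapply Rle_trans; [exact (A4' Dne Ene)|]. apply Rplus_le_compat_l.
      apply (Mono 2); [exact U1|exact HW4].
Qed.
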